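(* There exists a $1$-rotational $(pq+1,p+1,1)$-RBIBD over $\mathbb{F}_{p}^+ \times \mathbb{F}_{q}^+$ for any prime powers $p$ and $q$ with $p\equiv 3 \pmod{4}$, $q\equiv 1\pmod{p+1}$ and $q>Q((p+1)/2,p)$.
   Context: $\mathbb{F}_q^+$ is the additive group of the finite field $\mathbb{F}_q$. For positive integers $d,m$, $$Q(d,m)=\tfrac14\left(U+\sqrt{U^2+4d^{m-1}m}\right)^2,\qquad U=\sum_{h=1}^m \binom{m}{h}(d-1)^h(h-1).$$ A $(v,k,\lambda)$-BIBD is a pair $(V,\mathcal{A})$ where $V$ is a set of $v$ points and $\mathcal{A}$ is a collection of $k$-subsets of $V$ (blocks) such that every $2$-subset of $V$ is contained in exactly $\lambda$ blocks of $\mathcal{A}$. It is resolvable (a $(v,k,\lambda)$-RBIBD) if there exists a partition $\mathcal{R}$ of $\mathcal{A}$ (a resolution) into parallel classes, each of which is a partition of $V$. An automorphism group of a $(v,k,\lambda)$-RBIBD $(V,\mathcal{A})$ with resolution $\mathcal{R}$ is a group of permutations of $V$ leaving both $\mathcal{A}$ and $\mathcal{R}$ invariant. A $(v,k,\lambda)$-RBIBD is $1$-rotational over a group $G$ of order $v-1$ if it admits $G$ as an automorphism group fixing one point and acting sharply transitively on the other points. *)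

(* Defs.v *)
From mathcomp Require Export all_boot all_order all_algebra.
From mathcomp Require Export all_fingroup all_solvable all_field.

Set Implicit Arguments.
Unset Strict Implicit.
Unset Printing Implicit Defensive.

Import Order.TTheory GRing.Theory Num.Theory.

Definition prime_power (n : nat) : Prop :=
  exists r k : nat, [/\ prime r, 0 < k & n = r ^ k].

Section Bound.

Local Open Scope ring_scope.

Variable R : rcfType.

Definition U_bound (d m : nat) : R :=
  \sum_(1 <= h < m.+1) 'C(m, h)%:R * (d%:R - 1) ^+ h * (h%:R - 1).

Definition Q_bound (d m : nat) : R :=
  4^-1 * (U_bound d m +
          Num.sqrt (U_bound d m ^+ 2 + 4 * d%:R ^+ (m - 1)%N * m%:R)) ^+ 2.

End Bound.

Section Designs.

Variable V : finType.

(* Blocks form a set, not a multiset.  This loses nothing when lambda = 1 and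
   k >= 2: a repeated block would cover some pair of points twice. *)
Definition is_BIBD (v k lambda : nat) (A : {set {set V}}) : Prop :=
  [/\ #|V| = v,
      forall B : {set V}, B \in A -> #|B| = k
    & forall S : {set V}, #|S| = 2 ->
        #|[set B in A | S \subset B]| = lambda].

Definition is_resolution (A : {set {set V}}) (Rs : {set {set {set V}}}) : Prop :=
  partition Rs A /\
  (forall P : {set {set V}}, P \in Rs -> partition P [set: V]).

Definition is_RBIBD (v k lambda : nat) (A : {set {set V}})
    (Rs : {set {set {set V}}}) : Prop :=
  is_BIBD v k lambda A /\ is_resolution A Rs.

Definition automorphism_group (A : {set {set V}}) (Rs : {set {set {set V}}})
    (H : {group {perm V}}) : Prop :=
  forall g : {perm V}, g \in H ->
    [set g @: B | B : {set V} in A] = A /\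
    [set [set g @: B | B : {set V} in P] | P : {set {set V}} in Rs] = Rs.

Definition fixes_point (H : {group {perm V}}) (x0 : V) : Prop :=
  forall g : {perm V}, g \in H -> g x0 = x0.

Definition sharply_transitive_off (H : {group {perm V}}) (x0 : V) : Prop :=
  forall x y : V, x != x0 -> y != x0 ->
    exists! g : {perm V}, g \in H /\ g x = y.

(* "Admits G as an automorphism group" is read as: some group of permutations
   of the points that is isomorphic to G is an automorphism group. *)
Definition one_rotational_RBIBD (gT : finGroupType) (G : {group gT})
    (v k lambda : nat) (A : {set {set V}}) (Rs : {set {set {set V}}}) : Prop :=
  [/\ is_RBIBD v k lambda A Rs,
      #|G| = v - 1
    & exists (H : {group {perm V}}) (x0 : V),
        [/\ H \isog G, automorphism_group A Rs H,
            fixes_point H x0 & sharply_transitive_off H x0]].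

End Designs.

(* Main.v *)
Require Import Defs.
From HB Require Import structures.
From mathcomp Require Import zify ring lra.

(** Why the theorem is true.  Write d = (p + 1) / 2, so that d is even and
    2d divides q - 1.  The points are the elements of F_p x F_q and one point
    at infinity, and the group of translations acts.

    The design.  Let D be the set of squares of F_p, with 0: it has d elements,
    and since -1 is not a square every nonzero delta is a difference of exactly
    d / 2 ordered pairs of D ([paley_difference_set]).  Give each a in D an
    element y_a of F_q, let C be the group of d-th powers in F_q, which
    contains -1, and let S contain exactly one of u, -u for every u in C.  The
    base blocks are the sets of all (a, s y_a) and (a, - s y_a) with a in D,
    one for each s in S.  Their translates and the fibers F_p x {b}, completed
    by infinity, form the design; the class of the fiber over 0 consists of
    this fiber and of the translates of the base blocks by F_p x {0}, and the
    other parallel classes are its translates ([frame_design]).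
    The needed conditions are that the y_a lie in distinct cosets of C, and
    that for each nonzero delta the d elements y_a - y_b and y_a + y_b with
    a - b = delta lie in distinct cosets of C ([base_residues]).

    The choice of the y_a.  Prescribe the coset of each y_a and each y_a - y_b,
    y_a + y_b, and choose the y_a one after the other ([greedy_residues]).  At
    each step an x is wanted such that x - c lies in a prescribed coset of C,
    for at most 1 + 2(d - 1) = p distinct values of c.  Expanding the indicator
    functions of cosets into characters of order d, the number of solutions is
    positive as soon as q exceeds U sqrt(q) + p d^(p-1), if every character sum
    over a product of h nontrivial factors is at most (h - 1) sqrt(q)
    ([prescribed_classes]); this condition on q is exactly q > Q(d, p)
    ([Q_bound_weil]).

    The character sums ([weil_bound]).  The characters in question extend to
    all F_{q^k} through the norm; let S_k be the extended sum.  Sums A_n of the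
    same character over monic polynomials of degree n satisfy Newton's
    identities with respect to the S_k ([newton_monic_sum]), and A_n = 0 for
    n >= h ([monic_sum_eq0]).  Hence S_k = - sum_i w_i^k for at most h - 1
    complex numbers w_i, and |w_i| <= sqrt(q) follows from any estimate
    S_{2n} = O(q^n) ([power_sum_growth]).  The latter is the method of Stepanov
    in the form of Bombieri: with P = q^n, a nonzero polynomial Psi of degree
    P^2 / d + O(P) is found whose P-th power vanishes at all points of
    F_{q^2n} in a given class ([square_field_bound]).  That Psi is not zero
    is an independence statement about X and X^P ([frobenius_independence]). *)

Set Implicit Arguments.
Unset Strict Implicit.
Unset Printing Implicit Defensive.
Import Order.TTheory GRing.Theory Num.Theory.
Local Open Scope ring_scope.

(** * Pure powers in a field of rational functions *)


(** The factor has degree r with 0 < r < d, and its companion matrix C satisfies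
    C^d = a; taking determinants gives (det C)^d = a^r.  This replaces the
    irreducibility theory of X^d - a. *)
Lemma common_factor_pure_power (E : fieldType) (d : nat) (a : E) (P : {poly E}) :
  P != 0 -> (size P <= d)%N -> ~~ coprimep P ('X^d - a%:P) ->
  exists r (b : E), [/\ (0 < r)%N, (r < d)%N & b ^+ d = a ^+ r].
Proof.
move=> nzP szP; rewrite coprimep_def => ncop.
pose G0 := gcdp P ('X^d - a%:P).
have nzG0 : G0 != 0 by rewrite gcdp_eq0 negb_and nzP.
pose G := (lead_coef G0)^-1 *: G0.
have lc0 : (lead_coef G0)^-1 != 0 by rewrite invr_eq0 lead_coef_eq0.
have monG : G \is monic by rewrite monicE lead_coefZ mulVf ?lead_coef_eq0.
have szG : size G = size G0 by rewrite size_scale.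
have GP : G %| P by rewrite dvdpZl // dvdp_gcdl.
have GX : G %| 'X^d - a%:P by rewrite dvdpZl // dvdp_gcdr.
have rd : ((size G).-1 < d)%N.
  have sz0 : (0 < size G)%N by rewrite szG size_poly_gt0.
  by apply: leq_trans szP; rewrite prednK // dvdp_leq.
have r0 : (0 < (size G).-1)%N.
  have : (0 < size G)%N by rewrite szG size_poly_gt0.
  move: ncop; rewrite -/G0 -szG; by case: (size G) => [|[|n]].
have [n Dn] : exists n, n.+1 = (size G).-1 by exists (size G).-2; rewrite prednK.
have [C charC] : exists C : 'M[E]_n.+1, char_poly C = G.
  by move: Dn; move: n.+1 => n' ->; exists (companionmx G); rewrite companionmxK.
have CG : horner_mx C G = 0 by rewrite -charC Cayley_Hamilton.
have Cd : C ^+ d = a%:M.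
  apply/eqP; rewrite -subr_eq0; apply/eqP.
  have /dvdpP[H DH] := GX.
  have := congr1 (horner_mx C) DH.
  by rewrite rmorphM /= CG mulr0 rmorphB /= rmorphXn /= horner_mx_X horner_mx_C.
exists (size G).-1, (\det C); split=> //.
have -> : \det C ^+ d = \det (C ^+ d).
  elim: (d) => [|j IH]; first by rewrite !expr0 det1.
  by rewrite !exprS -mulmxE det_mulmx IH.
by rewrite Cd det_scalar Dn.
Qed.

Lemma frac_numden (R : idomainType) (x : {fraction R}) :
  exists u v : R, v != 0 /\ x = tofrac u / tofrac v.
Proof.
elim/quotW: x => y; exists (\n_y), (\d_y); split; first exact: denom_ratioP.
have nz : tofrac \d_y != 0 by rewrite tofrac_eq0 denom_ratioP.
apply: (mulIf nz); rewrite divfK //.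
unlock FracField.tofrac; rewrite -[LHS]FracField.pi_mul; apply/eqmodP => /=.
by rewrite FracField.equivfE !numden_Ratio ?mulr1 ?oner_neq0 ?denom_ratioP // mulrC.
Qed.

Lemma mup_exp (k : fieldType) (c : k) (u : {poly k}) n :
  u != 0 -> mup c (u ^+ n) = (n * mup c u)%N.
Proof.
move=> nzu; elim: n => [|n IH]; first by rewrite expr0 mupNroot // root1.
by rewrite exprS mupM ?expf_neq0 // IH mulSn.
Qed.

Lemma mup_prod (k : fieldType) (I : finType) (c : k) (u : I -> {poly k}) :
  (forall t, u t != 0) -> mup c (\prod_t u t) = (\sum_t mup c (u t))%N.
Proof.
move=> nzu; suff [] : (\prod_t u t != 0) /\
  mup c (\prod_t u t) = (\sum_t mup c (u t))%N by [].
apply: (big_rec2 (fun v n => v != 0 /\ mup c v = n)).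
  by rewrite oner_neq0 mupNroot // root1.
by move=> t n v _ [nzv <-]; rewrite mulf_neq0 // mupM.
Qed.

(** Write b = u / v and compare the multiplicities of c in the two sides of
    u^d = a^r v^d. *)
Lemma frac_pure_power_mup (k : fieldType) (a : {poly k}) (b : {fraction {poly k}})
    (d r : nat) (c : k) :
  a != 0 -> b ^+ d = tofrac a ^+ r -> (d %| r * mup c a)%N.
Proof.
move=> nza; have [u [v [nzv ->]]] := frac_numden b.
have nzv' : tofrac v ^+ d != 0 by rewrite expf_neq0 // tofrac_eq0.
rewrite expr_div_n => /(canRL (divfK nzv')) /eqP.
rewrite -!tofracXn -tofracM tofrac_eq => /eqP E.
have nzu : u ^+ d != 0 by rewrite E mulf_neq0 // expf_neq0.
case: d {nzv'} E nzu => [|d] E nzu.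
  move: E; rewrite !expr0 mulr1 => E.
  have: mup c (1 : {poly k}) = mup c (a ^+ r) by rewrite E.
  by rewrite mupNroot ?root1 // mup_exp // => <-.
have {}nzu : u != 0 by move: nzu; rewrite expf_eq0.
have := congr1 (mup c) E; rewrite mupM ?expf_neq0 // !mup_exp //.
by move=> /(congr1 (fun n => d.+1 %| n)%N); rewrite dvdn_mulr // dvdn_addl // dvdn_mulr.
Qed.

(** * Independence of a polynomial and its Frobenius image *)


(** In {poly {poly K}} the outer variable is called Z and the inner one X; the
    bound concerns X alone. *)
Definition degX_le (K : fieldType) (n : nat) (R : {poly {poly K}}) :=
  forall j, (size (R`_j)%R <= n.+1)%N.

Section DegX.
Variable K : fieldType.
Implicit Types R S : {poly {poly K}}.

Lemma degX_le0 n : degX_le n (0 : {poly {poly K}}).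
Proof. by move=> j; rewrite coef0 size_poly0. Qed.

Lemma degX_le1 n : degX_le n (1 : {poly {poly K}}).
Proof. by move=> j; rewrite coef1; case: eqP; rewrite ?size_poly1 ?size_poly0. Qed.

Lemma degX_leD n R S : degX_le n R -> degX_le n S -> degX_le n (R + S).
Proof.
move=> HR HS j; rewrite coefD; apply: leq_trans (size_polyD _ _) _.
by rewrite geq_max HR HS.
Qed.

Lemma degX_leN n R : degX_le n R -> degX_le n (- R).
Proof. by move=> HR j; rewrite coefN size_polyN. Qed.

Lemma degX_le_sum (I : finType) n (R : I -> {poly {poly K}}) :
  (forall i, degX_le n (R i)) -> degX_le n (\sum_i R i).
Proof.
by move=> HR; elim/big_ind: _ => //; [apply: degX_le0 | apply: degX_leD].
Qed.

Lemma degX_leM n n' R S : degX_le n R -> degX_le n' S -> degX_le (n + n') (R * S).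
Proof.
move=> HR HS j; rewrite coefM; elim/big_ind: _ => [|p q Hp Hq|i _].
- by rewrite size_poly0.
- by apply: leq_trans (size_polyD _ _) _; rewrite geq_max Hp Hq.
apply: leq_trans (size_polyMleq _ _) _.
by have := HR i; have := HS (j - i)%N; lia.
Qed.

Lemma degX_le_prod (I : finType) (n : I -> nat) (R : I -> {poly {poly K}}) :
  (forall i, degX_le (n i) (R i)) -> degX_le (\sum_i n i) (\prod_i R i).
Proof.
move=> HR; apply: (big_rec2 (fun m S => degX_le m S)); first exact: degX_le1.
by move=> i m S _; apply: degX_leM.
Qed.

(** The bounds depend on the row because only about half of the rows of the
    Sylvester matrix have a large degree; a uniform bound would lose a factor 2,
    which the later counting of unknowns and equations cannot afford. *)
Lemma degX_le_det d (n : 'I_d -> nat) (M : 'M[{poly {poly K}}]_d) :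
  (forall i j, degX_le (n i) (M i j)) -> degX_le (\sum_i n i) (\det M).
Proof.
move=> HM; apply: degX_le_sum => s.
rewrite -signr_odd; case: (odd _); rewrite ?expr0 ?expr1 ?mul1r ?mulN1r.
  by apply/degX_leN/degX_le_prod => i.
exact: degX_le_prod.
Qed.

Lemma degX_le_resultant (A m : nat) (P Q : {poly {poly {poly K}}}) :
  (forall i, degX_le A P`_i) -> (forall i, degX_le m Q`_i) ->
  degX_le ((size Q).-1 * A + (size P).-1 * m)%N (resultant P Q).
Proof.
move=> HP HQ; rewrite /resultant.
pose n (i : 'I_((size Q).-1 + (size P).-1)) := if split i is inl _ then A else m.
have -> : ((size Q).-1 * A + (size P).-1 * m = \sum_i n i)%N.
  rewrite big_split_ord /=; congr (_ + _)%N.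
    rewrite (eq_bigr (fun=> A)) ?sum_nat_const ?card_ord // => i _.
    by rewrite /n (unsplitK (inl i)).
  rewrite (eq_bigr (fun=> m)) ?sum_nat_const ?card_ord // => i _.
  by rewrite /n (unsplitK (inr i)).
apply: degX_le_det => i j; rewrite Sylvester_mxE /n.
by case: (split i) => k; case: (_ <= _)%N;
   rewrite ?mulr0n ?mulr1n //; apply: degX_le0.
Qed.

(** If the coefficients have degree less than N, the monomials X^i Z^j become
    distinct monomials X^(i + N j): base N expansions are unique. *)
Lemma horner_Xn_eq0 N R :
  (forall j, (size (R`_j)%R <= N)%N) -> R.['X^N] = 0 -> R = 0.
Proof.
elim/poly_ind: R => // R p IH HR.
have Hp : (size p <= N)%N by have := HR 0%N; rewrite coefD coefMX coefC add0r.
rewrite hornerMXaddC => E.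
suff R0 : R.['X^N] = 0.
  rewrite IH //; first by move: E; rewrite R0 mul0r add0r => ->; rewrite mul0r addr0.
  by move=> j; have := HR j.+1; rewrite coefD coefMX coefC /= addr0.
apply/polyP=> j; have := congr1 (fun q : {poly K} => q`_(j + N)) E.
rewrite coefD coefMXn ltnNge leq_addl addnK /= !coef0.
by rewrite (nth_default 0 (leq_trans Hp (leq_addl j N))) addr0.
Qed.

End DegX.

(** Stated for an abstract morphism, which keeps unification away from the
    concrete tower of fractions. *)
Lemma map_binomial (D : comNzRingType) (F : fieldType) (h : {rmorphism D -> F})
    (u v : D) (x : F) (d : nat) :
  h u * x = h v ->
  map_poly h (u%:P * 'X^d - v%:P) = h u *: ('X^d - x%:P).
Proof.
move=> E; rewrite rmorphB rmorphM /= !map_polyC map_polyXn scalerBr -mul_polyC.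
by rewrite -[h u *: x%:P]mul_polyC -polyCM E.
Qed.

Lemma resultant0_map_ncoprime (R : idomainType) (F : fieldType)
    (h : {rmorphism {poly R} -> F}) (P Q : {poly {poly R}}) :
  injective h -> P != 0 -> Q != 0 -> resultant P Q = 0 ->
  ~~ coprimep (map_poly h P) (map_poly h Q).
Proof.
move=> inj_h nzP nzQ res0.
have nz (S : {poly {poly R}}) : S != 0 -> h (lead_coef S) != 0.
  by move=> nzS; rewrite -(rmorph0 h) (inj_eq inj_h) lead_coef_eq0.
have := map_resultant (nz _ nzP) (nz _ nzQ).
rewrite res0 rmorph0 => /esym/eqP; rewrite resultant_eq0 => H.
by rewrite coprimep_def neq_ltn H orbT.
Qed.

Lemma mup_CsubX (k : fieldType) (x y : k) :
  mup x (y%:P - 'X) = (if y == x then 1 else 0)%N.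
Proof.
have -> : y%:P - 'X = (-1)%:P * ('X - y%:P) :> {poly k}.
  by rewrite polyCN mulNr mul1r opprB.
rewrite mupMr ?rootC ?oppr_eq0 ?oner_eq0 //.
by rewrite -['X - _]expr1 mup_XsubCX.
Qed.

Lemma mup_prod_CsubX (k : fieldType) (I : finType) (c : I -> k) (e : I -> nat)
    (u : k) (t : I) :
  injective c -> u != 0 ->
  mup (c t) (u *: \prod_s ((c s)%:P - 'X) ^+ e s) = e t.
Proof.
move=> inj_c nzu; rewrite -mul_polyC mupMr ?rootC //.
have nz s : (c s)%:P - 'X != 0 by rewrite -opprB oppr_eq0 polyXsubC_eq0.
rewrite mup_prod => [|s]; last by rewrite expf_neq0.
rewrite (bigD1 t) //= big1 ?addn0 => [|s st].
  by rewrite mup_exp // mup_CsubX eqxx muln1.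
by rewrite mup_exp // mup_CsubX ifN ?muln0 // (inj_eq inj_c).
Qed.

Lemma prod_CsubX_neq0 (k : fieldType) (I : finType) (c : I -> k) (e : I -> nat) :
  \prod_t ((c t)%:P - 'X) ^+ e t != 0.
Proof.
apply/prodf_neq0 => t _; rewrite expf_neq0 // -opprB oppr_eq0.
by rewrite polyXsubC_eq0.
Qed.

Section FrobeniusIndependence.

Variables (K : fieldType) (I : finType) (c : I -> K) (e : I -> nat) (d m A N : nat).
Hypothesis inj_c : injective c.
Hypothesis d_gt0 : (0 < d)%N.
Hypothesis d_e : forall r, (forall t, d %| r * e t)%N -> (d %| r)%N.
Let f : {poly K} := \prod_t ((c t)%:P - 'X) ^+ e t.
Hypothesis sz_f : (size f <= m.+1)%N.
Variable g : {poly K}.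
Hypothesis g_f : g ^+ d * f = f \Po 'X^N.
Hypothesis ltN : (d * A + (d.-1) * m < N)%N.

Let EX : fieldType := {fraction {poly K}}.
Let E : fieldType := {fraction {poly EX}}.
Let toEX : {rmorphism K -> EX} := [the {rmorphism K -> EX} of
   (@FracField.tofrac {poly K}) \o polyC].
Let phi : {rmorphism {poly {poly K}} -> E} := [the {rmorphism {poly {poly K}} -> E} of
   (@FracField.tofrac {poly EX}) \o map_poly (@FracField.tofrac {poly K})].

Lemma to_frac_inj : injective phi.
Proof.
move=> u v /eqP; rewrite /phi /= tofrac_eq => /eqP.
apply: map_inj_poly => [x y /eqP|]; last exact: tofrac0.
by rewrite tofrac_eq => /eqP.
Qed.

(** The elements g^i X^(N j), i < d, are independent over the polynomials in X
    of small degree.  Let P(X, Z, T) vanish at Z = X^N, T = g.  There g is a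
    root of f(X) T^d - f(Z), so the resultant in T of P and this binomial
    vanishes at Z = X^N, and it is 0 since its degree in X is less than N.  Hence
    over K(X, Z) the binomial has a factor of some degree r with 0 < r < d in
    common with P, and (f(Z) / f(X))^r is a d-th power there.  Looking at
    Z = c_t, d divides r e_t for all t, hence d divides r: a contradiction. *)
Lemma frobenius_independence (P : {poly {poly {poly K}}}) :
  (size P <= d)%N -> (forall i, degX_le A P`_i) ->
  (map_poly (horner_eval 'X^N) P).[g] = 0 -> P = 0.
Proof.
move=> szP HP Pg; apply/eqP; apply/negPn/negP => nzP.
have smallA (u : {poly {poly K}}) n : (n < N)%N -> degX_le n u -> u.['X^N] = 0 -> u = 0.
  by move=> nN Hu; apply: horner_Xn_eq0 => j; apply: leq_trans (Hu j) _.
have [szP1|szP1] := leqP (size P) 1.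
  have DP := size1_polyC szP1.
  case/negP: nzP; rewrite DP polyC_eq0.
  rewrite DP map_polyC /= hornerC /horner_eval in Pg; apply/eqP.
  by apply: smallA (HP 0%N) Pg; have : (0 < d * 1)%N; [rewrite muln1 | nia].
(* al = f(X), be = f(Z), and Q is the binomial f(X) T^d - f(Z) *)
pose al : {poly {poly K}} := f%:P; pose be : {poly {poly K}} := f^:P.
pose Q : {poly {poly {poly K}}} := al%:P * 'X^d - be%:P.
have nzal : al != 0 by rewrite polyC_eq0 prod_CsubX_neq0.
have szQ : size Q = d.+1.
  rewrite size_polyDl.
    by rewrite mul_polyC size_scale // size_polyXn.
  by rewrite size_polyN mul_polyC size_scale // size_polyXn ltnS (leq_trans (size_polyC_leq1 _)).
have nzQ : Q != 0 by rewrite -size_poly_gt0 szQ.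
have HQ i : degX_le m Q`_i.
  rewrite coefD coefN coefCM coefXn coefC; apply: degX_leD; last apply: degX_leN.
    case: eqP => _; last by rewrite mulr0; apply: degX_le0.
    by move=> j; rewrite mulr1 coefC; case: eqP; rewrite ?size_poly0.
  case: eqP => _ j; last by rewrite coef0 size_poly0.
  by rewrite coef_map (leq_trans (size_polyC_leq1 _)).
have Qg : (map_poly (horner_eval 'X^N) Q).[g] = 0.
  rewrite rmorphB rmorphM /= !map_polyC /= map_polyXn !hornerE.
  rewrite /horner_eval hornerC. rewrite mulrC g_f.
  by rewrite /be /comp_poly subrr.
have szQ1 : (1 < size Q)%N by rewrite szQ ltnS.
have [[u v] /= _ Duv] := resultant_in_ideal szP1 szQ1.
have res0 : resultant P Q = 0.
  have degR := degX_le_resultant HP HQ.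
  apply: (smallA _ _ _ degR).
    rewrite szQ /=; apply: leq_ltn_trans ltN; rewrite leq_add2l leq_mul2r; apply/orP; right.
    by rewrite -!subn1 leq_sub2r.
  have : (map_poly (horner_eval 'X^N) (resultant P Q)%:P).[g] = 0.
    by rewrite Duv rmorphD !rmorphM hornerD !hornerM Pg Qg !mulr0 addr0.
  by rewrite map_polyC hornerC.
pose P' : {poly E} := map_poly phi P.
have szP' : size P' = size P by rewrite size_map_inj_poly ?rmorph0 //; apply: to_frac_inj.
have nzP' : P' != 0 by rewrite -size_poly_eq0 szP' size_poly_eq0.
pose alX : EX := tofrac f.
have nzalX : alX != 0 by rewrite tofrac_eq0 prod_CsubX_neq0.
pose beX : {poly EX} := map_poly toEX f.
pose a : {poly EX} := alX^-1 *: beX.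
have DbeX : beX = \prod_t ((toEX (c t))%:P - 'X) ^+ e t.
  rewrite /beX /f rmorph_prod; apply: eq_bigr => t _.
  by rewrite rmorphXn rmorphB /= map_polyC map_polyX.
have nzbeX : beX != 0.
  by rewrite DbeX (@prod_CsubX_neq0 _ _ (fun t => toEX (c t))).
have nza : a != 0 by rewrite scaler_eq0 negb_or nzbeX invr_eq0 nzalX.
have phial : phi al = tofrac alX%:P by rewrite /phi /= /al map_polyC.
have phibe : phi be = tofrac beX.
  by rewrite /phi /= /be /beX -map_poly_comp.
have nzphial : phi al != 0 by rewrite phial tofrac_eq0 polyC_eq0.
have DQ' : map_poly phi Q = phi al *: ('X^d - (tofrac a)%:P).
  apply: map_binomial; rewrite phial phibe -tofracM.
  by congr tofrac; rewrite mul_polyC /a scalerA mulfV // scale1r.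
have ncop : ~~ coprimep P' ('X^d - (tofrac a)%:P).
  by rewrite -(coprimepZr _ _ nzphial) -DQ' resultant0_map_ncoprime //; exact: to_frac_inj.
have szP'd : (size P' <= d)%N by rewrite szP'.
have [r [b [r0 rd Db]]] := common_factor_pure_power nzP' szP'd ncop.
have : (d %| r)%N.
  apply: d_e => t.
  have := frac_pure_power_mup (toEX (c t)) nza Db.
  rewrite /a DbeX (@mup_prod_CsubX _ _ (fun s => toEX (c s))) ?invr_eq0 // => x y.
  by rewrite /toEX /= => /eqP; rewrite tofrac_eq => /eqP /polyC_inj /inj_c.
by move/(dvdn_leq r0); rewrite leqNgt rd.
Qed.

End FrobeniusIndependence.

(** * Points of a field with a square number of elements *)


(** More polynomials than coefficients: a kernel vector exists. *)
Lemma poly_dependence (K : fieldType) (T : finType) (b : T -> {poly K}) (M : nat) :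
  (forall t, (size (b t) <= M)%N) -> (M < #|T|)%N ->
  exists k : T -> K, (exists t, k t != 0) /\ \sum_t k t *: b t = 0.
Proof.
move=> szb MT.
pose X : 'M[K]_(#|T|, M) := \matrix_i poly_rV (b (enum_val i)).
have : kermx X != 0.
  rewrite kermx_eq0; apply/negP => /eqP rX.
  by move: (rank_leq_col X); rewrite rX leqNgt MT.
case/rowV0Pn => v /sub_kermxP vX nzv.
exists (fun t => v 0 (enum_rank t)); split.
  have /existsP[i Hi] : [exists i, v 0 i != 0].
    apply: contraR nzv; rewrite negb_exists => /forallP H.
    by apply/eqP/rowP => i; rewrite mxE; apply/eqP; have := H i; rewrite negbK.
  by exists (enum_val i); rewrite enum_valK.
apply/polyP => j; rewrite coef_sum coef0.
have [jM|jM] := ltnP j M; last first.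
  rewrite big1 // => t _; rewrite coefZ nth_default ?mulr0 //.
  exact: leq_trans (szb t) jM.
transitivity ((v *m X) 0 (Ordinal jM)); last by rewrite vX mxE.
rewrite mxE (reindex_onto enum_val enum_rank) /=; last first.
  by move=> t _; rewrite enum_rankK.
apply: eq_big => [i|i _]; first by rewrite enum_valK eqxx.
by rewrite enum_valK coefZ !mxE.
Qed.

Lemma pchar_sum_exp (R : comNzRingType) (T : Type) (r : seq T) (Q : pred T)
    (F : T -> R) (n : nat) : [pchar R].-nat n ->
  (\sum_(t <- r | Q t) F t) ^+ n = \sum_(t <- r | Q t) F t ^+ n.
Proof.
move=> nn; have n0 : (0 < n)%N by case/andP: nn.
apply: (big_morph (fun x => x ^+ n)) => [x y|]; first exact: exprDn_pchar.
by rewrite expr0n; case: n n0 {nn}.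
Qed.

Lemma size_prod_CsubX (K : fieldType) (I : finType) (c : I -> K) (e : I -> nat) :
  (size (\prod_t ((c t)%:P - 'X) ^+ e t)%R <= (\sum_t e t).+1)%N.
Proof.
apply: (big_rec2 (fun n (u : {poly K}) => (size u <= n.+1)%N)).
  by rewrite size_poly1.
move=> t n u _ Hu; apply: leq_trans (size_polyMleq _ _) _.
have : (size (((c t)%:P - 'X) ^+ e t) <= (e t).+1)%N.
  apply: leq_trans (size_poly_exp_leq _ _) _.
  by rewrite -opprB size_polyN size_XsubC mul1n.
lia.
Qed.

Section SquareFieldBound.

Variables (K : closedFieldType) (I : finType) (c : I -> K) (e : I -> nat).
Variables (d m B P : nat).
Hypothesis inj_c : injective c.
Hypothesis d_gt0 : (0 < d)%N.
Hypothesis d_e : forall r, (forall t, d %| r * e t)%N -> (d %| r)%N.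
Hypothesis sum_e : (\sum_t e t = m)%N.
Hypothesis DP : (P = d * B + 1)%N.
Hypothesis charP : [pchar K].-nat P.
Hypothesis c_fixed : forall t, c t ^+ P = c t.
Hypothesis largeB : ((d * m + 1) * (m + 3) < B)%N.
Let f : {poly K} := \prod_t ((c t)%:P - 'X) ^+ e t.
Let g : {poly K} := f ^+ B.

Lemma size_radicand : (size f <= m.+1)%N.
Proof. by rewrite -sum_e; apply: size_prod_CsubX. Qed.

Lemma size_g_exp i : (size (g ^+ i) <= (B * i * m).+1)%N.
Proof.
rewrite /g -exprM; apply: leq_trans (size_poly_exp_leq _ _) _.
rewrite ltnS mulnC leq_mul2l; apply/orP; right.
by have := size_radicand; case: (size f).
Qed.

Lemma radicand_power_frobenius : g ^+ d * f = f \Po 'X^P.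
Proof.
rewrite /g -exprM -exprSr -addn1 mulnC -DP /f rmorph_prod /= -prodrXl.
apply: eq_bigr => t _; rewrite rmorphXn /= rmorphB /= comp_polyC comp_polyX.
rewrite -exprM mulnC exprM; congr (_ ^+ _).
have charP' : [pchar {poly K}].-nat P.
  by apply: sub_in_pnat charP => q _; rewrite pchar_poly.
rewrite -[_ - _]/(_ + _) exprDn_pchar // exprNn_pchar //.
by rewrite -polyC_exp c_fixed.
Qed.

Let A := (B - m)%N.
Let J := (B + m + 3)%N.
Let T : finType := ('I_d * 'I_J * 'I_A)%type.

(** Stepanov's method in Bombieri's form.  With g = f^B, the points in question
    satisfy x^(P^2) = x and g(x)^(P + 1) = z.  For
      Psi = sum k_ija X^a g^i X^(P j)
    this gives Psi(x)^P g(x)^(d-1) = sum k_ija^P x^(P a + j) z^i g(x)^(d-1-i),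
    and the right side can be made identically zero, for there are d J A unknowns
    k_ija^P and fewer coefficients.  So Psi vanishes at all the points, of which
    there are at most deg Psi, about J P = (B + O(1)) P.  The values A = B - m
    and J = B + m + 3 are the ones for which Psi is nonzero by
    [frobenius_independence] and the linear system is underdetermined. *)
Lemma square_field_bound (z : K) (xs : seq K) : z != 0 -> uniq xs ->
  (forall x, x \in xs -> x ^+ (P ^ 2)%N = x /\ f.[x] ^+ (B * (P + 1))%N = z) ->
  (size xs <= B + m * P + (B + m + 3) * P)%N.
Proof.
move=> nz_z uniq_xs Hxs.
(* the terms of the right side, without their unknown coefficients *)
pose b (t : T) : {poly K} :=
  'X^(t.2 * P + t.1.2) * (z ^+ t.1.1 *: g ^+ (d.-1 - t.1.1)).
have szb t : (size (b t) <= (A.-1 * P + J.-1) + d.-1 * m * B + 1)%N.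
  have szg : (size (z ^+ t.1.1 *: g ^+ (d.-1 - t.1.1))%R <= (B * d.-1 * m).+1)%N.
    apply: leq_trans (size_scale_leq _ _) _.
    apply: leq_trans (size_g_exp _) _.
    by rewrite ltnS leq_mul2r leq_mul2l leq_subr !orbT.
  apply: leq_trans (size_polyMleq _ _) _; rewrite size_polyXn.
  have h1 : (t.2 * P <= A.-1 * P)%N.
    by rewrite leq_mul2r; apply/orP; right; have := ltn_ord t.2; lia.
  have h2 : (t.1.2 <= J.-1)%N by have := ltn_ord t.1.2; lia.
  move: szg h1 h2; set s := size _; rewrite mulnAC [(B * m * _)%N]mulnC mulnA.
  lia.
have cardT : (#|{: T}| = d * J * A)%N by rewrite !card_prod !card_ord.
have [|k0 [[t0 nzt0] Hk0]] := poly_dependence szb.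
  rewrite cardT /A /J DP; clear - largeB d_gt0.
  by case: d d_gt0 largeB => // d' _ /=; nia.
(* the linear system determines the P-th powers of the coefficients of Psi *)
have rootsP t : exists y : K, y ^+ P == k0 t.
  have P0 : (0 < P)%N by rewrite DP addn1.
  have [y Hy] := @solve_monicpoly K P (fun i => if i == 0%N then k0 t else 0) P0.
  exists y; rewrite Hy (bigD1 (Ordinal P0)) //= big1 ?addr0 ?mulr1 // => i.
  by rewrite -val_eqE /= => /negPf ->; rewrite mul0r.
pose k t := xchoose (rootsP t).
have kP t : k t ^+ P = k0 t by apply/eqP/(xchooseP (rootsP t)).
pose Psi : {poly K} := \sum_t k t *: ('X^(t.2 + t.1.2 * P) * g ^+ t.1.1).
have szPsi : (size Psi <= (A + m * P + J * P).+1)%N.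
  apply: leq_trans (size_sum _ _ _) _; apply/bigmax_leqP => t _.
  apply: leq_trans (size_scale_leq _ _) _.
  apply: leq_trans (size_polyMleq _ _) _; rewrite size_polyXn.
  have h1 := size_g_exp t.1.1.
  have h2 : (B * t.1.1 * m <= m * P)%N.
    rewrite DP mulnC leq_mul2l; apply/orP; right; rewrite mulnC.
    by apply: leq_trans (leq_addr _ _); rewrite leq_mul2r (ltnW (ltn_ord _)) orbT.
  have h3 : (t.1.2 * P <= J * P)%N by rewrite leq_mul2r (ltnW (ltn_ord _)) orbT.
  have := ltn_ord t.2; lia.
have nzPsi : Psi != 0.
  apply/eqP => Psi0.
  pose mon (t : T) : {poly {poly {poly K}}} :=
    (((k t)%:P * 'X^(t.2))%:P * 'X^(t.1.2))%:P * 'X^(t.1.1).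
  suff E : \sum_t mon t = 0.
    have := congr1 (fun u : {poly {poly {poly K}}} => u`_(t0.1.1)`_(t0.1.2)`_(t0.2)) E.
    rewrite !coef0 !coef_sum (bigD1 t0) //= big1 => [|t tt0].
      rewrite addr0 /mon; do 3 rewrite coefCM coefXn eqxx mulr1; move=> k0'.
      by case/eqP: nzt0; rewrite -kP k0' expr0n DP addn1.
    rewrite /mon !coefCM !coefXn.
    case: eqP => [e1|_]; last by rewrite mulr0 !coef0.
    rewrite mulr1 !coefCM !coefXn.
    case: eqP => [e2|_]; last by rewrite mulr0 !coef0.
    rewrite mulr1 !coefCM !coefXn.
    case: eqP => [e3|_]; last by rewrite mulr0.
    case/eqP: tt0; case: t e1 e2 e3 => [[t1 t2] t3] /= e1 e2 e3.
    by case: t0 {nzt0} e1 e2 e3 => [[u1 u2] u3] /= /val_inj -> /val_inj -> /val_inj ->.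
  apply: (@frobenius_independence K I c e d m A P inj_c d_gt0 d_e size_radicand g
    radicand_power_frobenius).
  - rewrite DP /A; have := largeB; case: d d_gt0 => // d' _ /=; nia.
  - apply: leq_trans (size_sum _ _ _) _; apply/bigmax_leqP => t _.
    rewrite /mon mul_polyC; apply: leq_trans (size_scale_leq _ _) _.
    by rewrite size_polyXn.
  - move=> i; rewrite coef_sum; apply: degX_le_sum => t j.
    rewrite /mon !(coefCM, coefXn); case: eqP => _; last by rewrite mulr0 coef0 size_poly0.
    rewrite mulr1 !(coefCM, coefXn); case: eqP => _; last by rewrite mulr0 size_poly0.
    rewrite mulr1 mul_polyC; apply: leq_trans (size_scale_leq _ _) _.
    by rewrite size_polyXn ltnS ltnW.
  rewrite rmorph_sum horner_sum -[RHS]Psi0; apply: eq_bigr => t _.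
  have evM u n : (map_poly (horner_eval 'X^P) (u%:P * 'X^n)).[g] = u.['X^P] * g ^+ n.
    by rewrite rmorphM /= map_polyC map_polyXn hornerM hornerC hornerXn.
  rewrite [LHS]evM hornerM hornerC hornerXn -exprM mulnC.
  by rewrite -mul_polyC exprD !mulrA.
have rPsi x : x \in xs -> root Psi x.
  case/Hxs => xP fx.
  have nzg : g.[x] != 0.
    apply: contra nz_z => /eqP g0; rewrite -fx exprM -horner_exp -/g g0.
    by rewrite expr0n addn1.
  have gP : g.[x] ^+ P.+1 = z by rewrite /g horner_exp -exprM -addn1.
  suff : Psi.[x] ^+ P * g.[x] ^+ d.-1 == 0.
    rewrite mulf_eq0 [X in _ || X]expf_eq0 (negPf nzg) andbF orbF expf_eq0.
    by case/andP.
  apply/eqP; transitivity (\sum_t k0 t *: b t).[x]; last by rewrite Hk0 horner0.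
  rewrite /Psi !horner_sum pchar_sum_exp // mulr_suml; apply: eq_bigr => t _.
  rewrite /b !hornerZ !hornerM !hornerXn hornerZ !horner_exp !exprMn kP.
  rewrite -mulrA; congr (_ * _).
  rewrite -![f.[x] ^+ B]horner_exp -/g -[x ^+ _ ^+ P]exprM mulnDl -mulnA mulnn !exprD.
  rewrite [(t.1.2 * _)%N]mulnC [x ^+ (P ^ 2 * _)]exprM xP -!mulrA; congr (_ * (_ * _)).
  have id1 : (t.1.1 <= d.-1)%N by have := ltn_ord t.1.1; lia.
  have -> : g.[x] ^+ d.-1 = g.[x] ^+ t.1.1 * g.[x] ^+ (d.-1 - t.1.1).
    by rewrite -exprD subnKC.
  by rewrite mulrA -exprM mulnC exprM -exprMn -exprSr gP.
have := max_poly_roots nzPsi _ uniq_xs; rewrite /A in szPsi *.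
have -> : all (root Psi) xs by apply/allP.
move=> /(_ isT) /leq_trans /(_ szPsi); rewrite ltnS => /leq_trans; apply.
by rewrite /A /J; lia.
Qed.
End SquareFieldBound.

(** * Finite subfields of an algebraic closure *)


Lemma card_finField_pchar (F : finFieldType) : [pchar F].-nat #|F|.
Proof.
have [p pr_p pcharFp] := finPcharP F.
have /abelem_pgroup/card_pgroup := fin_ring_pchar_abelem pcharFp.
rewrite cardsT => ->; rewrite pnatX; apply/orP; left.
by rewrite pnatE.
Qed.

(** The exponent n is a power of the characteristic, so that this is a ring
    morphism; the proof is an argument to let the instances be inferred. *)
Definition power_map (R : comNzRingType) (n : nat) of [pchar R].-nat n :=
  fun x : R => x ^+ n.

Section PowerMap.
Variables (R : comNzRingType) (n : nat) (charn : [pchar R].-nat n).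

Fact power_map_is_zmod_morphism : zmod_morphism (power_map charn).
Proof. by move=> x y; rewrite /power_map exprDn_pchar // exprNn_pchar. Qed.

Fact power_map_is_monoid_morphism : monoid_morphism (power_map charn).
Proof. by split=> [|x y]; rewrite /power_map ?expr1n ?exprMn. Qed.

HB.instance Definition _ := GRing.isZmodMorphism.Build R R (power_map charn)
  power_map_is_zmod_morphism.
HB.instance Definition _ := GRing.isMonoidMorphism.Build R R (power_map charn)
  power_map_is_monoid_morphism.
End PowerMap.

Section Closure.

Variables (F : finFieldType) (K : closedFieldType) (iota : {rmorphism F -> K}).
Local Notation q := #|F|.
Local Notation "p ^iota" := (map_poly iota p) (at level 2).

Lemma charK_card : [pchar K].-nat q.
Proof.
apply: sub_in_pnat (card_finField_pchar F) => p _ pF.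
by rewrite (fmorph_pchar iota).
Qed.

Lemma charK_cardX k : [pchar K].-nat (q ^ k)%N.
Proof. by rewrite pnatX charK_card. Qed.

Lemma iota_fixed (a : F) k : iota a ^+ (q ^ k) = iota a.
Proof.
elim: k => [|k IH]; first by rewrite expr1.
by rewrite expnS exprM -rmorphXn expf_card.
Qed.

(** The q elements of F are already all the roots of X^q - X. *)
Lemma fixed_iota (y : K) : y ^+ q = y -> exists a, iota a = y.
Proof.
move=> Hy; have := congr1 (fun u => (map_poly iota u).[y]) (finField_genPoly F).
rewrite rmorphB rmorph_prod /= map_polyXn map_polyX !hornerE Hy subrr.
move/esym/eqP; rewrite horner_prod prodf_seq_eq0 => /hasP[a _ /=].
rewrite rmorphB /= map_polyX map_polyC !hornerE subr_eq0 => /eqP ->.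
by exists a.
Qed.

(** A total inverse of the embedding, with an arbitrary value outside its image. *)
Definition iota_inv (y : K) : F := odflt 0 [pick a | iota a == y].

Lemma iota_invK y : y ^+ q = y -> iota (iota_inv y) = y.
Proof.
case/fixed_iota => a Ha; rewrite /iota_inv; case: pickP => [b /eqP //|/(_ a)].
by rewrite Ha eqxx.
Qed.

Lemma iotaK a : iota_inv (iota a) = a.
Proof. by apply: (fmorph_inj iota); rewrite iota_invK // -[q]expn1 iota_fixed. Qed.

(** The subfield with q^k elements, as the list of roots of X^(q^k) - X: all
    finite extensions of F live inside one algebraic closure, which avoids towers
    of field types. *)
Definition subfield_points (k : nat) : seq K :=
  sval (closed_field_poly_normal ('X^(q ^ k) - 'X)).
Local Notation pts := subfield_points.

Lemma card_base_gt1 : (1 < q)%N. Proof. exact: finNzRing_gt1. Qed.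

Lemma card_base_exp_gt1 k : (0 < k)%N -> (1 < q ^ k)%N.
Proof. by move=> k0; rewrite -[X in (X < _)%N](expn0 q) ltn_exp2l // card_base_gt1. Qed.

Lemma pts_prod k : (0 < k)%N ->
  'X^(q ^ k) - 'X = \prod_(z <- pts k) ('X - z%:P).
Proof.
move=> k0; rewrite /pts; case: closed_field_poly_normal => r /= Hr.
rewrite {1}Hr (_ : lead_coef _ = 1) ?scale1r //.
rewrite lead_coefDl ?lead_coefXn // size_polyN size_polyX size_polyXn ltnS.
exact: card_base_exp_gt1.
Qed.

Lemma size_pts k : (0 < k)%N -> size (pts k) = (q ^ k)%N.
Proof.
move=> k0; apply: succn_inj; rewrite -(size_prod_XsubC _ id) -pts_prod //.
by rewrite size_polyDl ?size_polyXn // size_polyN size_polyX ltnS card_base_exp_gt1.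
Qed.

Lemma uniq_pts k : (0 < k)%N -> uniq (pts k).
Proof.
move=> k0; rewrite -separable_prod_XsubC -pts_prod //.
rewrite unlock derivB derivXn derivX -mulr_natl.
have -> : (q ^ k)%:R = 0 :> {poly K}.
  have [p pr_p pcharp] := finPcharP F.
  rewrite natrX -polyC_natr -(rmorph_nat iota).
  have -> : q%:R = 0 :> F.
    have /andP[_ /allP H] := card_finField_pchar F.
    apply/eqP; rewrite -(dvdn_pcharf pcharp).
    have qp : #|F| = (p ^ logn p #|F|)%N.
      have /abelem_pgroup/card_pgroup := fin_ring_pchar_abelem pcharp.
      by rewrite cardsT.
    have := card_base_gt1; rewrite qp; case: (logn _ _) => // n _.
    by rewrite expnS dvdn_mulr.
  by rewrite rmorph0 polyC0 expr0n; case: k k0.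
by rewrite mul0r add0r coprimep_sym -scaleN1r coprimepZl ?(coprimep_sym 1) ?coprimep1 // oppr_eq0 oner_eq0.
Qed.

Lemma mem_pts k x : (0 < k)%N -> (x \in pts k) = (x ^+ (q ^ k) == x).
Proof.
by move=> k0; rewrite -root_prod_XsubC -pts_prod // rootE !hornerE subr_eq0.
Qed.

(** For x in the field with q^k elements this is the characteristic polynomial
    of x over F, a power of the minimal polynomial; its value at c is the norm of
    c - x. *)
Definition cpolyK (k : nat) (x : K) : {poly K} :=
  \prod_(i < k) ('X - (x ^+ (q ^ i))%:P).

Definition cpoly (k : nat) (x : K) : {poly F} := map_poly iota_inv (cpolyK k x).

(** The coefficients are fixed by the q-th power map, hence lie in F. *)
Lemma poly_fixed_iota (u : {poly K}) :
  map_poly (power_map charK_card) u = u ->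
  (map_poly iota_inv u)^iota = u.
Proof.
move=> Hu; apply/polyP => i; rewrite coef_map coef_map_id0 /=; last first.
  by rewrite -(rmorph0 iota) iotaK.
rewrite iota_invK //.
by have := congr1 (fun v : {poly K} => v`_i) Hu; rewrite coef_map.
Qed.

Lemma cpolyKE k x : (0 < k)%N -> x \in pts k -> (cpoly k x)^iota = cpolyK k x.
Proof.
move=> k0; rewrite mem_pts // => /eqP Hx; apply: poly_fixed_iota.
rewrite /cpolyK rmorph_prod /=.
case: k k0 Hx => // k _ Hx; rewrite big_ord_recr big_ord_recl /= mulrC.
congr (_ * _).
  by rewrite rmorphB /= map_polyX map_polyC /= /power_map -exprM mulnC -expnS Hx expr1.
apply: eq_bigr => i _.
by rewrite rmorphB /= map_polyX map_polyC /= /power_map -exprM mulnC -expnS.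
Qed.

Lemma monic_cpolyK k x : cpolyK k x \is monic.
Proof. exact: monic_prod_XsubC. Qed.

Lemma size_cpolyK k x : size (cpolyK k x) = k.+1.
Proof. by rewrite /cpolyK size_prod_XsubC /= /index_enum -enumT size_enum_ord. Qed.

Lemma monic_cpoly k x : (0 < k)%N -> x \in pts k -> cpoly k x \is monic.
Proof. by move=> k0 xk; rewrite -(map_monic iota) cpolyKE // monic_cpolyK. Qed.

Lemma size_cpoly k x : (0 < k)%N -> x \in pts k -> size (cpoly k x) = k.+1.
Proof. by move=> k0 xk; rewrite -(size_map_poly iota) cpolyKE // size_cpolyK. Qed.

End Closure.

(** * Frobenius orbits of roots *)


Section Counting.

Variables (F : finFieldType) (K : closedFieldType) (iota : {rmorphism F -> K}).
Local Notation q := #|F|.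
Local Notation "p ^iota" := (map_poly iota p) (at level 2).
Local Notation pts := (subfield_points F K).

Lemma powK_inj k : injective (fun x : K => x ^+ (q ^ k)).
Proof.
move=> x y /= E; apply/eqP; rewrite -subr_eq0.
have : (x - y) ^+ (q ^ k) == 0.
  by rewrite exprDn_pchar ?exprNn_pchar ?(charK_cardX iota) // E subrr.
by rewrite expf_eq0 => /andP[].
Qed.

Lemma root_pow (h : {poly F}) x k : root h^iota x -> root h^iota (x ^+ (q ^ k)).
Proof.
move=> /eqP hx; apply/eqP.
have E : map_poly (power_map (charK_cardX iota k)) h^iota = h^iota.
  by apply/polyP => i; rewrite !coef_map /= /power_map iota_fixed.
rewrite -{1}E (horner_map (power_map (charK_cardX iota k))) /= /power_map hx.
by rewrite expr0n eqn0Ngt expn_gt0 ltnW ?card_base_gt1.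
Qed.

Lemma pts_sub i j x : (i < j)%N -> x ^+ (q ^ i) = x ^+ (q ^ j) -> x \in pts (j - i).
Proof.
move=> ij E; rewrite mem_pts ?subn_gt0 //; apply/eqP.
by apply: (@powK_inj i); rewrite /= -exprM -expnD subnK // ltnW.
Qed.

Lemma pts_add r k x : (0 < r)%N -> (0 < k)%N -> x \in pts r ->
  (x \in pts (k + r)) = (x \in pts k).
Proof.
move=> r0 k0; rewrite !mem_pts ?addn_gt0 ?k0 // => /eqP Hr.
by rewrite addnC expnD exprM Hr.
Qed.

Lemma cpolyK_add r k x : (0 < r)%N -> x \in pts r ->
  cpolyK F (k + r) x = cpolyK F r x * cpolyK F k x.
Proof.
move=> r0; rewrite mem_pts // => /eqP Hr.
rewrite /cpolyK addnC big_split_ord /=; congr (_ * _); apply: eq_bigr => i _.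
by rewrite expnD exprM Hr.
Qed.

Lemma cpoly_dvd_root k x (h : {poly F}) : (0 < k)%N -> x \in pts k ->
  cpoly iota k x %| h -> root h^iota x.
Proof.
move=> k0 xk; rewrite -(dvdp_map iota) cpolyKE // => Hd.
rewrite -dvdp_XsubCl; apply: dvdp_trans Hd; case: k k0 {xk} => // k _.
by rewrite /cpolyK big_ord_recl /= expn0 expr1 dvdp_mulr.
Qed.

(** The conjugates of a root are roots, so the first repetition among them
    occurs within n steps; before it they are pairwise distinct, and the product
    of the corresponding linear factors divides the polynomial. *)
Lemma frobenius_orbit n (h : {poly F}) x : size h = n.+1 -> root h^iota x ->
  exists r, [/\ (0 < r <= n)%N, x \in pts r,
    forall k, (0 < k < r)%N -> x \notin pts k &
    cpolyK F r x %| h^iota /\ mup x (cpolyK F r x) = 1%N].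
Proof.
move=> szh hx.
have nzH : h^iota != 0 by rewrite -size_poly_eq0 size_map_poly szh.
have ex : exists r, (0 < r <= n)%N && (x \in pts r).
  have /(uniqPn 0)[i [j [ij jn E]]] : ~~ uniq (mkseq (fun i => x ^+ (q ^ i)) n.+1).
    apply/negP => U; have := max_poly_roots nzH _ U.
    rewrite size_mkseq size_map_poly szh ltnn => /(_ _)/negP; case=> //.
    by apply/allP => y /mapP[i _ ->]; apply: root_pow.
  rewrite size_mkseq in jn; rewrite !nth_mkseq ?(ltn_trans ij) // in E.
  exists (j - i)%N; rewrite subn_gt0 ij (pts_sub ij E) andbT /=.
  by rewrite leq_subLR; apply: leq_trans (leq_addl _ _).
case: (ex_minnP ex) => r /andP[/andP[r0 rn] xr] rmin; exists r.
have notin k : (0 < k < r)%N -> x \notin pts k.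
  move=> /andP[k0 kr]; apply/negP => xk; have := rmin k.
  by rewrite k0 xk andbT (leq_trans (ltnW kr) rn) => /(_ isT); rewrite leqNgt kr.
have U : uniq (mkseq (fun i => x ^+ (q ^ i)) r).
  apply/negPn/negP => /(uniqPn 0)[i [j [ij]]]; rewrite size_mkseq => jr.
  rewrite !nth_mkseq ?(ltn_trans ij) // => E.
  have /notin : (0 < j - i < r)%N by rewrite subn_gt0 ij (leq_ltn_trans (leq_subr _ _) jr).
  by rewrite (pts_sub ij E).
have DcK : cpolyK F r x = \prod_(z <- mkseq (fun i => x ^+ (q ^ i)) r) ('X - z%:P).
  by rewrite /cpolyK big_map -(big_mkord xpredT (fun i => 'X - (x ^+ (q ^ i))%:P)) /index_iota subn0.
split=> //; first by rewrite r0.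
split.
  rewrite DcK; apply: uniq_roots_dvdp; last by rewrite uniq_rootsE.
  by apply/allP => y /mapP[i _ ->]; apply: root_pow.
rewrite DcK mu_prod_XsubC count_uniq_mem //.
case: r r0 {rn xr rmin notin U DcK} => // r _.
by rewrite inE /= expn0 expr1 eqxx.
Qed.

(** Induction on the degree: if r is the period of x, dividing h by the minimal
    polynomial of x lowers the multiplicity of x by one, and shifts by r the
    values of k that are counted. *)
Lemma orbit_count n (h : {poly F}) x : h \is monic -> size h = n.+1 ->
  (\sum_(1 <= k < n.+1) ((x \in pts k) && (cpoly iota k x %| h)%R) =
   mup x h^iota)%N.
Proof.
elim/ltn_ind: n h => n IH h mon_h szh.
have [hx|hx] := boolP (root h^iota x); last first.
  rewrite mupNroot // big_nat big1 // => k /andP[k0 _].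
  by case xk: (x \in pts k) => //=; case: (boolP (_ %| _)) => // /(cpoly_dvd_root k0 xk); rewrite (negPf hx).
have [r [/andP[r0 rn] xr notin [dvr mr]]] := frobenius_orbit szh hx.
have : cpoly iota r x %| h by rewrite -(dvdp_map iota) cpolyKE.
case/dvdpP => h' Dh.
have mon_r := monic_cpoly iota r0 xr.
have mon_h' : h' \is monic by move: mon_h; rewrite Dh monicMr.
have szh' : size h' = (n - r).+1.
  have := szh; rewrite Dh size_Mmonic ?monic_neq0 // size_cpoly // addnS /= => E.
  by rewrite -subSn // -E addnK.
have nr : (n - r < n)%N by rewrite -subn_gt0 subKn.
have IH' := IH _ nr h' mon_h' szh'.
have nz' : h'^iota != 0 by rewrite map_poly_eq0 monic_neq0.
have -> : mup x h^iota = (1 + mup x h'^iota)%N.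
  rewrite Dh rmorphM /= cpolyKE // mupM // ?mr 1?addnC //.
  by rewrite monic_neq0 // monic_cpolyK.
rewrite (@big_cat_nat _ _ _ r) //=; last by rewrite ltnW.
rewrite big_nat big1 ?add0n => [|k Hk]; last by rewrite (negPf (notin k Hk)).
rewrite big_ltn // xr Dh dvdp_mulIr /=; congr (_ + _)%N.
rewrite -[r.+1]add1n big_addn -IH' subSn //.
rewrite !big_nat; apply: eq_bigr => k /andP[k0 _].
rewrite pts_add //; case xk: (x \in pts k) => //=; congr (nat_of_bool _).
have xkr : x \in pts (k + r) by rewrite pts_add.
rewrite -(dvdp_map iota) -[RHS](dvdp_map iota) rmorphM /= !cpolyKE ?addn_gt0 ?k0 //.
by rewrite cpolyK_add // [X in _ %| X]mulrC dvdp_mul2l // monic_neq0 // monic_cpolyK.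
Qed.

End Counting.

(** * Newton identities for sums over monic polynomials *)


Section Newton.

Variables (F : finFieldType) (K : closedFieldType) (iota : {rmorphism F -> K}).
Local Notation q := #|F|.
Local Notation "p ^iota" := (map_poly iota p) (at level 2).
Local Notation pts := (subfield_points F K).

Lemma size_undup_sum (T : eqType) (s : seq T) :
  (\sum_(x <- undup s) count_mem x s = size s)%N.
Proof.
rewrite -[RHS]sum1_size.
transitivity (\sum_(x <- undup s) \sum_(z <- s) (z == x))%N.
  by apply: eq_bigr => x _; rewrite -sum1_count [LHS]big_mkcond; apply: eq_bigr => z _ /=; case: (z == x).
rewrite exchange_big /= big_seq [RHS]big_seq; apply: eq_bigr => z zs.
transitivity (count_mem z (undup s)).
  rewrite -sum1_count [RHS]big_mkcond; apply: eq_bigr => x _ /=.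
  by rewrite eq_sym; case: (_ == _).
by rewrite count_uniq_mem ?undup_uniq // mem_undup zs.
Qed.

(** Sum [orbit_count] over the roots: their multiplicities add up to n.  This
    count replaces the factorization into irreducible polynomials. *)
Lemma total_orbit_count n (h : {poly F}) : h \is monic -> size h = n.+1 ->
  (\sum_(1 <= k < n.+1) \sum_(x <- pts k) (cpoly iota k x %| h)%R = n)%N.
Proof.
move=> mon_h szh.
have [zs Dzs] := closed_field_poly_normal h^iota.
have monH : h^iota \is monic by rewrite map_monic.
rewrite (eqP monH) scale1r in Dzs.
have szzs : size zs = n.
  by apply: succn_inj; rewrite -(size_prod_XsubC _ id) -Dzs size_map_poly.
have rootE x : root h^iota x = (x \in undup zs).
  by rewrite Dzs root_prod_XsubC mem_undup.
transitivity (\sum_(x <- undup zs) mup x h^iota)%N; last first.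
  rewrite -szzs -[RHS]size_undup_sum; apply: eq_bigr => x _.
  by rewrite Dzs mu_prod_XsubC.
transitivity (\sum_(x <- undup zs) \sum_(1 <= k < n.+1)
   ((x \in pts k) && (cpoly iota k x %| h)%R))%N; last first.
  by apply: eq_bigr => x _; rewrite orbit_count.
rewrite exchange_big /= big_nat [RHS]big_nat; apply: eq_bigr => k /andP[k0 _].
transitivity (count (fun x => cpoly iota k x %| h) (pts k)).
  by rewrite -sum1_count [RHS]big_mkcond; apply: eq_bigr => x _; case: ifP.
transitivity (count (fun x => (x \in pts k) && (cpoly iota k x %| h)) (undup zs)); last first.
  by rewrite -sum1_count big_mkcond; apply: eq_bigr => x _; case: ifP.
rewrite -!size_filter; apply: perm_size; apply: uniq_perm.
- by rewrite filter_uniq // (uniq_pts iota).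
- by rewrite filter_uniq // undup_uniq.
move=> x; rewrite !mem_filter; case xk: (x \in pts k); rewrite ?andbF //= andbT.
case: (boolP (_ %| _)) => //= /(cpoly_dvd_root k0 xk).
by rewrite rootE => ->.
Qed.

(** Monic polynomials of degree n are parametrized by row vectors, in order to
    be summed over a finite type. *)
Definition monic_of (n : nat) (a : 'rV[F]_n) : {poly F} := 'X^n + rVpoly a.

Lemma size_rVpoly n (a : 'rV[F]_n) : (size (rVpoly a) <= n)%N.
Proof. exact: size_poly. Qed.

Lemma size_monic_of n a : size (@monic_of n a) = n.+1.
Proof. by rewrite size_polyDl size_polyXn // ltnS size_rVpoly. Qed.

Lemma monic_monic_of n a : @monic_of n a \is monic.
Proof. by rewrite monicE lead_coefDl ?lead_coefXn // size_polyXn ltnS size_rVpoly. Qed.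

Lemma monic_ofK n (a : 'rV[F]_n) : poly_rV (monic_of a - 'X^n) = a.
Proof. by rewrite /monic_of addrC addKr rVpolyK. Qed.

Lemma monic_of_rV n (h : {poly F}) : h \is monic -> size h = n.+1 ->
  monic_of (poly_rV (h - 'X^n) : 'rV_n) = h.
Proof.
move=> mon_h szh.
have sz : (size (h - 'X^n)%R <= n)%N.
  apply/leq_sizeP => j; rewrite coefB coefXn leq_eqVlt => /orP[/eqP <-|nj].
    by have := monicP mon_h; rewrite lead_coefE szh /= => ->; rewrite eqxx subrr.
  by rewrite gtn_eqF // nth_default ?subrr // szh.
by rewrite /monic_of (poly_rV_K sz) addrC subrK.
Qed.

Variables (C : comNzRingType) (lam : {poly F} -> C).
Hypothesis lam1 : lam 1 = 1.
Hypothesis lamM : forall u v, lam (u * v) = lam u * lam v.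

(** The coefficient of T^n in the L-function of the multiplicative function
    lam. *)
Definition monic_sum (n : nat) : C := \sum_(a : 'rV[F]_n) lam (monic_of a).
Definition point_sum (k : nat) : C := \sum_(x <- pts k) lam (cpoly iota k x).

Lemma monic_sum0 : monic_sum 0 = 1.
Proof.
rewrite /monic_sum (big_pred1 0) => [|a]; last by rewrite /= [a]thinmx0 eqxx.
by rewrite /monic_of expr0 linear0 addr0.
Qed.

Lemma monic_sum_dvd n k (g : {poly F}) : g \is monic -> size g = k.+1 ->
  (k <= n)%N ->
  \sum_(a : 'rV[F]_n | g %| monic_of a) lam (monic_of a) =
  lam g * monic_sum (n - k).
Proof.
move=> mon_g szg kn; rewrite mulr_sumr.
have mon_gb (b : 'rV_(n - k)) : g * monic_of b \is monic.
  by rewrite monicMl // monic_monic_of.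
have sz_gb (b : 'rV_(n - k)) : size (g * monic_of b) = n.+1.
  by rewrite size_Mmonic ?monic_neq0 ?monic_monic_of // szg size_monic_of addnS /= addSn subnKC.
have nzg : g != 0 by rewrite monic_neq0.
rewrite (reindex_onto (fun b : 'rV_(n - k) => poly_rV (g * monic_of b - 'X^n) : 'rV_n)
  (fun a => poly_rV (monic_of a %/ g - 'X^(n - k)))) /=; last first.
  move=> a ga; rewrite monic_of_rV.
  - by rewrite mulrC divpK // monic_ofK.
  - by rewrite -(monicMr _ mon_g) divpK // monic_monic_of.
  by rewrite size_divp // size_monic_of szg /= subSn.
apply: eq_big => [b|b _]; rewrite monic_of_rV ?lamM //.
by rewrite dvdp_mulIl mulrC mulpK // monic_ofK eqxx.
Qed.

(** This is T L'(T) / L(T) = sum S_k T^k, coefficientwise.  Replace the factor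
    n by the count of [total_orbit_count] and exchange summations; the monic
    multiples of a given divisor are summed by [monic_sum_dvd]. *)
Lemma newton_monic_sum n :
  n%:R * monic_sum n = \sum_(1 <= k < n.+1) point_sum k * monic_sum (n - k).
Proof.
rewrite /monic_sum mulr_sumr.
transitivity (\sum_(a : 'rV[F]_n) \sum_(1 <= k < n.+1) \sum_(x <- pts k)
   (cpoly iota k x %| monic_of a)%R%:R * lam (monic_of a)).
  apply: eq_bigr => a _.
  rewrite -{1}(total_orbit_count (monic_monic_of a) (size_monic_of a)).
  rewrite natr_sum mulr_suml; apply: eq_bigr => k _.
  by rewrite natr_sum mulr_suml.
rewrite exchange_big /= big_nat [RHS]big_nat; apply: eq_bigr => k /andP[k0 kn].
rewrite exchange_big /= /point_sum mulr_suml big_seq [RHS]big_seq.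
apply: eq_bigr => x xk.
rewrite -[RHS](@monic_sum_dvd n k) ?monic_cpoly ?size_cpoly //.
rewrite [RHS]big_mkcond; apply: eq_bigr => a _.
by case: (_ %| _); rewrite ?mul1r ?mul0r.
Qed.

End Newton.

(** * Power sums and the size of their bases *)


Section PowerSums.

(** Newton's relation between the coefficients a of a power series with constant
    term 1 and the sequence s of its power sums, up to sign. *)
Definition newton_rel (R : comNzRingType) (a s : nat -> R) :=
  forall n, n%:R * a n = \sum_(1 <= k < n.+1) s k * a (n - k)%N.

Lemma newton_rel_unique (R : comNzRingType) (a s s' : nat -> R) :
  a 0%N = 1 -> newton_rel a s -> newton_rel a s' ->
  forall k, (0 < k)%N -> s k = s' k.
Proof.
move=> a0 Hs Hs'; elim/ltn_ind => -[|n] // IH _.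
have := Hs n.+1; rewrite Hs' 2?(@big_nat_recr _ _ _ n.+1) //= subnn a0 !mulr1.
rewrite (_ : \sum_(1 <= i < n.+1) s i * _ = \sum_(1 <= i < n.+1) s' i * a (n.+1 - i)%N).
  by move/addrI.
by rewrite !big_nat; apply: eq_bigr => k /andP[k0 kn]; rewrite IH.
Qed.

(** Multiplying by 1 - w T adds - w^k to the k-th power sum: a telescoping
    sum. *)
Lemma newton_rel_prod (R : comNzRingType) (ws : seq R) :
  newton_rel (fun n => (\prod_(w <- ws) (1 - w *: 'X))`_n)
             (fun k => - \sum_(w <- ws) w ^+ k).
Proof.
rewrite /newton_rel; elim: ws => [|w ws IH] n /=.
  rewrite [RHS]big1 => [|k _]; last by rewrite big_nil oppr0 mul0r.
  by rewrite big_nil coef1; case: n => [|n]; rewrite ?mul0r ?mulr0.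
rewrite /= in IH; set m : {poly R} := \prod_(w <- ws) (1 - w *: 'X) in IH *.
have coefE j : (\prod_(v <- w :: ws) (1 - v *: 'X))`_j =
    m`_j - w * (if j is i.+1 then m`_i else 0).
  rewrite big_cons -/m mulrBl mul1r coefB -scalerAl coefZ coefXM.
  by case: j.
rewrite coefE.
transitivity (\sum_(1 <= k < n.+1) ((- \sum_(v <- ws) v ^+ k) * m`_(n - k)
   - w * ((- \sum_(v <- ws) v ^+ k) * (if (n - k)%N is i.+1 then m`_i else 0))
   - (w ^+ k * m`_(n - k)
      - w ^+ k.+1 * (if (n - k)%N is i.+1 then m`_i else 0)))); last first.
  apply: eq_bigr => k _; rewrite coefE big_cons exprS.
  move: (\sum_(v <- ws) v ^+ k) (m`_(n - k)) (match _ with 0%N => 0 | i.+1 => m`_i end) (w ^+ k) => x1 x2 x3 x4.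
  by ring.
rewrite !big_split /= -IH.
case: n => [|n].
  by rewrite !big_geq // !mul0r !addr0.
have -> : \sum_(1 <= k < n.+2) - (w * ((- \sum_(v <- ws) v ^+ k) *
   (if (n.+1 - k)%N is i.+1 then m`_i else 0))) = - (w * (n%:R * m`_n)).
  rewrite IH big_nat_recr //= subnn !mulr0 oppr0 addr0 mulr_sumr -sumrN.
  rewrite !big_nat; apply: eq_bigr => k /andP[k0 kn].
  by rewrite subSn.
have -> : \sum_(1 <= k < n.+2) - (w ^+ k * m`_(n.+1 - k) - w ^+ k.+1 *
   (if (n.+1 - k)%N is i.+1 then m`_i else 0)) = - (w * m`_n).
  rewrite sumrN; congr (- _).
  rewrite (telescope_sumr_eq (fun k => - (w ^+ k * (if (n.+2 - k)%N is i.+1 then m`_i else 0)))) //.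
    by rewrite subnn mulr0 oppr0 add0r opprK expr1 subn1.
  move=> k /andP[k0 kn]; rewrite subSS [in X in _ = _ - X]subSn //.
  by rewrite opprK addrC.
ring.
Qed.

Lemma poly_prod_1subX (R : closedFieldType) (p : {poly R}) : p`_0 = 1 ->
  exists ws : seq R, size ws = (size p).-1 /\ p = \prod_(w <- ws) (1 - w *: 'X).
Proof.
move=> p0; have [zs Dp] := closed_field_poly_normal p.
have nzp : p != 0.
  by apply/eqP => E; move/eqP: p0; rewrite E coef0 eq_sym oner_eq0.
have szp : size p = (size zs).+1.
  by rewrite Dp size_scale ?lead_coef_eq0 // size_prod_XsubC.
have nz z : z \in zs -> z != 0.
  move=> zzs; apply/eqP => z0; move/eqP: p0.
  have : root p 0 by rewrite Dp rootZ ?lead_coef_eq0 // root_prod_XsubC -z0.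
  by move/rootP; rewrite horner_coef0 => ->; rewrite eq_sym oner_eq0.
exists [seq z^-1 | z <- zs]; rewrite size_map szp; split=> //.
rewrite big_map.
have E : \prod_(z <- zs) ('X - z%:P) =
   (\prod_(z <- zs) - z) *: \prod_(z <- zs) (1 - z^-1 *: 'X).
  rewrite -scaler_prod; apply: eq_big_seq => z /nz nzz.
  by rewrite scalerBr scalerA mulNr divff // scaleN1r opprK alg_polyC polyCN addrC.
rewrite {1}Dp E scalerA.
have : (lead_coef p * \prod_(z <- zs) - z) * (\prod_(z <- zs) (1 - z^-1 *: 'X)).[0] = 1.
  by have := p0; rewrite -horner_coef0 {1}Dp E scalerA hornerZ.
have -> : (\prod_(z <- zs) (1 - z^-1 *: 'X)).[0] = 1.
  by rewrite horner_prod big1 // => z _; rewrite !hornerE subr0.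
by rewrite mulr1 => ->; rewrite scale1r.
Qed.

Lemma bernoulli (t : algC) n : 0 <= t -> 1 + n%:R * t <= (1 + t) ^+ n.
Proof.
move=> t0; elim: n => [|n IH]; first by rewrite mul0r addr0.
rewrite exprS mulrDl mul1r -natr1 mulrDl mul1r addrA lerD //.
rewrite -[leLHS]mulr1 ler_wpM2l //; apply: le_trans IH.
by rewrite lerDl mulr_ge0.
Qed.

(** A polynomial that vanishes at all the other bases isolates the powers of
    one base w0 as a fixed combination of consecutive power sums, so |w0|^n is
    O(rho^n).  No cancellation can hide a large base since the multiplicities are
    positive. *)
Lemma power_sum_growth (ws : seq algC) (c rho : algC) (n0 : nat) : 0 < rho ->
  (forall n, (n0 <= n)%N -> `|\sum_(w <- ws) w ^+ n| <= c * rho ^+ n) ->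
  forall w, w \in ws -> `|w| <= rho.
Proof.
move=> rho0 Hs w0 w0ws.
pose p : {poly algC} := \prod_(v <- rem w0 (undup ws)) ('X - v%:P).
have pw v : v \in ws -> v != w0 -> p.[v] = 0.
  move=> vws vw; apply/rootP; rewrite root_prod_XsubC.
  by rewrite (mem_rem_uniq _ (undup_uniq ws)) !inE vw mem_undup.
have nzp : p.[w0] != 0.
  rewrite -rootE root_prod_XsubC.
  by rewrite (mem_rem_uniq _ (undup_uniq ws)) !inE eqxx.
pose b : algC := (count_mem w0 ws)%:R * `|p.[w0]|.
have b0 : 0 < b.
  by rewrite mulr_gt0 ?normr_gt0 // ltr0n -has_count has_pred1.
have Tn n : \sum_(i < size p) p`_i * \sum_(w <- ws) w ^+ (n + i) =
    (count_mem w0 ws)%:R * (w0 ^+ n * p.[w0]).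
  under eq_bigr => i _ do rewrite mulr_sumr.
  rewrite exchange_big /=.
  transitivity (\sum_(w <- ws) w ^+ n * p.[w]).
    apply: eq_bigr => w _; rewrite horner_coef mulr_sumr; apply: eq_bigr => i _.
    by rewrite exprD mulrCA.
  rewrite -sum1_count natr_sum mulr_suml [RHS]big_mkcond big_seq [RHS]big_seq.
  apply: eq_bigr => w wws /=; case: eqP => [->|/eqP ww]; first by rewrite mul1r.
  by rewrite pw // mulr0.
pose c' : algC := \sum_(i < size p) `|p`_i| * (c * rho ^+ i).
have bound n : (n0 <= n)%N -> b * `|w0| ^+ n <= c' * rho ^+ n.
  move=> n0n.
  have -> : b * `|w0| ^+ n = `|(count_mem w0 ws)%:R * (w0 ^+ n * p.[w0])|.
    by rewrite !normrM normr_nat normrX /b -mulrA [`|p.[_]| * _]mulrC.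
  rewrite -Tn; apply: le_trans (ler_norm_sum _ _ _) _.
  rewrite /c' mulr_suml; apply: ler_sum => i _.
  rewrite normrM -mulrA ler_wpM2l // -mulrA -exprD addnC.
  by apply: Hs; apply: leq_trans n0n (leq_addl _ _).
rewrite real_leNgt ?normr_real ?gtr0_real //; apply/negP => lt_w.
pose t : algC := `|w0| / rho - 1.
have t0 : 0 < t by rewrite subr_gt0 ltr_pdivlMr // mul1r.
have tb n : (n0 <= n)%N -> b * (1 + n%:R * t) <= c'.
  move=> n0n; apply: le_trans (_ : b * (1 + t) ^+ n <= _).
    by rewrite ler_wpM2l ?(ltW b0) // bernoulli // ltW.
  rewrite /t addrC subrK expr_div_n mulrA ler_pdivrMr ?exprn_gt0 //.
  exact: bound.
have c'0 : 0 <= c'.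
  by apply: le_trans (tb _ (leqnn n0)); rewrite mulr_ge0 ?(ltW b0) // addr_ge0 // mulr_ge0 // ltW.
have x0 : 0 <= c' / (b * t) by rewrite divr_ge0 // mulr_ge0 // ltW.
have := archi_boundP x0; set N := Num.bound _; move=> HN.
have := tb _ (leq_maxl n0 N); apply/negP.
rewrite -real_ltNge ?ger0_real //; last first.
  by rewrite mulr_ge0 ?(ltW b0) // addr_ge0 // mulr_ge0 // ltW.
have HN2 : c' < N%:R * (b * t) by move: HN; rewrite ltr_pdivrMr //; apply: mulr_gt0.
apply: lt_le_trans HN2 _.
rewrite mulrCA ler_wpM2l ?(ltW b0) //.
apply: le_trans (_ : (maxn n0 N)%:R * t <= _); last by rewrite lerDr.
by rewrite ler_wpM2r ?(ltW t0) // ler_nat leq_maxr.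
Qed.

End PowerSums.

(** * Characters of a finite field *)


(** A character extended by 0 whose values have order dividing d and whose kernel
    contains only d-th powers, the last condition being expressed by the power
    residue symbol. *)
Definition exact_character (F : finFieldType) (d : nat) (chi : F -> algC) : Prop :=
  [/\ chi 0 = 0, chi 1 = 1, forall x y, chi (x * y) = chi x * chi y,
      forall x, x != 0 -> chi x ^+ d = 1 &
      forall x, x != 0 -> chi x = 1 -> x ^+ (#|F|.-1 %/ d) = 1].

Section Characters.

Variables (F : finFieldType) (d : nat) (chi : F -> algC).
Hypothesis d_gt1 : (1 < d)%N.
Hypothesis d_dvd : (d %| #|F|.-1)%N.
Hypothesis chiP : exact_character d chi.

Lemma chi0 : chi 0 = 0. Proof. by case: chiP. Qed.
Lemma chi1 : chi 1 = 1. Proof. by case: chiP. Qed.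
Lemma chiM x y : chi (x * y) = chi x * chi y. Proof. by case: chiP. Qed.
Lemma chi_root x : x != 0 -> chi x ^+ d = 1. Proof. by case: chiP => _ _ _ + _; apply. Qed.

Lemma chi_neq0 x : x != 0 -> chi x != 0.
Proof.
move=> /chi_root /eqP E; apply/eqP => x0; move: E.
by rewrite x0 expr0n gtn_eqF ?(ltnW d_gt1) // eq_sym oner_eq0.
Qed.

Lemma chi_prod (I : finType) (u : I -> F) : chi (\prod_t u t) = \prod_t chi (u t).
Proof. exact: (big_morph chi chiM chi1). Qed.

Lemma chiX x n : chi (x ^+ n) = chi x ^+ n.
Proof. by elim: n => [|n IH]; rewrite ?chi1 // !exprS chiM IH. Qed.

Lemma chi_eq_power x y : x != 0 -> y != 0 -> chi x = chi y ->
  x ^+ (#|F|.-1 %/ d) = y ^+ (#|F|.-1 %/ d).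
Proof.
move=> nzx nzy E; have [_ _ _ _ H] := chiP.
have nzxy : x / y != 0 by rewrite mulf_neq0 // invr_neq0.
have : chi (x / y) = 1.
  by apply: (mulIf (chi_neq0 nzy)); rewrite -chiM divfK // mul1r.
move/(H _ nzxy); rewrite expr_div_n => /(canRL (divfK _)) ->; rewrite ?mul1r //.
by rewrite expf_neq0.
Qed.

(** Otherwise all nonzero elements are roots of X^n - 1 with n < q - 1. *)
Lemma chi_nontrivial e : (0 < e < d)%N -> exists2 u, u != 0 & chi u ^+ e != 1.
Proof.
move=> /andP[e0 ed]; have [_ _ _ _ H] := chiP.
have q1 : (0 < #|F|.-1)%N by rewrite -ltnS prednK ?finNzRing_gt1 // ltnW // finNzRing_gt1.
pose n := (e * (#|F|.-1 %/ d))%N.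
have n0 : (0 < n)%N by rewrite muln_gt0 e0 divn_gt0 ?(ltnW d_gt1) // dvdn_leq.
have nq : (n < #|F|.-1)%N.
  rewrite /n -[X in (_ < X)%N](divnK d_dvd) [X in (_ < X)%N]mulnC ltn_pmul2r //.
  by rewrite divn_gt0 ?(ltnW d_gt1) // dvdn_leq.
case: (pickP (fun u : F => (u != 0) && (chi u ^+ e != 1))) => [u /andP[]|none].
  by exists u.
have rts : all (root ('X^n - 1 : {poly F})) (enum (predC1 (0 : F))).
  apply/allP => u; rewrite mem_enum inE => nzu.
  rewrite rootE !hornerE subr_eq0 exprM; apply/eqP; apply: H.
    by rewrite expf_neq0.
  by rewrite chiX; apply/eqP; have := none u; rewrite nzu => /negbT; rewrite negbK.
have nz : 'X^n - 1 != 0 :> {poly F} by rewrite -size_poly_gt0 size_XnsubC.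
have := max_poly_roots nz rts (enum_uniq _).
by rewrite size_XnsubC // -cardE cardC1 ltnS leqNgt nq.
Qed.

Lemma chi_sum0 e : (0 < e < d)%N -> \sum_b chi b ^+ e = 0.
Proof.
move=> he; have [u nzu Hu] := chi_nontrivial he.
have E : \sum_b chi b ^+ e = chi u ^+ e * \sum_b chi b ^+ e.
  rewrite mulr_sumr {1}(reindex_inj (mulfI nzu)); apply: eq_bigr => b _.
  by rewrite chiM exprMn.
apply/eqP; have : (1 - chi u ^+ e) * \sum_b chi b ^+ e == 0.
  by rewrite mulrBl mul1r -E subrr.
by rewrite mulf_eq0 subr_eq0 eq_sym (negPf Hu).
Qed.

Variables (I : finType) (c : I -> F) (e : I -> nat).
Hypothesis inj_c : injective c.
Hypothesis e_lt : forall t, (e t < d)%N.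
Hypothesis e_prim : forall r, (forall t, d %| r * e t)%N -> (d %| r)%N.

(** Completely multiplicative in h.  An exponent 0 makes a factor 1 even where
    h vanishes, so only the indices in the support of e matter. *)
Definition poly_char (h : {poly F}) : algC := \prod_t chi h.[c t] ^+ e t.
Local Notation lam := poly_char.
Let h : nat := #|[set t | e t != 0%N]|.
Let m := (\sum_t e t)%N.

Lemma poly_char1 : lam 1 = 1.
Proof. by apply: big1 => t _; rewrite hornerC chi1 expr1n. Qed.

Lemma poly_charM u v : lam (u * v) = lam u * lam v.
Proof. by rewrite /lam -big_split; apply: eq_bigr => t _; rewrite hornerM chiM exprMn. Qed.

Lemma exists_pos_exponent : exists t, (0 < e t)%N.
Proof.
apply/existsP; apply: contraT; rewrite negb_exists => /forallP H.
have : (d %| 1)%N.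
  by apply: e_prim => t; have := H t; rewrite lt0n negbK => /eqP ->; rewrite muln0.
by rewrite dvdn1 gtn_eqF.
Qed.

Lemma support_gt0 : (0 < h)%N.
Proof. by have [t Ht] := exists_pos_exponent; apply/card_gt0P; exists t; rewrite inE -lt0n. Qed.

(** Adding multiples of l = prod (X - c_t), over the indices of the support
    other than t1, changes only the value at c_t1, and makes it run through the
    whole field.  The sum of a nontrivial character over the field is 0. *)
Lemma monic_sum_eq0 n : (h <= n)%N -> monic_sum lam n = 0.
Proof.
move=> hn; have [t1 e1] := exists_pos_exponent.
pose l : {poly F} := \prod_(t | (e t != 0%N) && (t != t1)) ('X - (c t)%:P).
have szl : (size l <= n)%N.
  rewrite /l -big_filter size_prod_XsubC -sum1_size big_filter sum1dep_card.
  apply: leq_trans hn; rewrite /h [X in (_ <= X)%N](cardsD1 t1) inE -lt0n e1 ltnS.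
  apply: subset_leq_card; apply/subsetP => t; rewrite !inE => /andP[-> ->] //.
have l1 : l.[c t1] != 0.
  rewrite /l horner_prod; apply/prodf_neq0 => t /andP[_ tt1].
  by rewrite !hornerE subr_eq0 (inj_eq inj_c) eq_sym.
have l0 t : t != t1 -> e t != 0%N -> l.[c t] = 0.
  move=> tt1 et; rewrite /l horner_prod (bigD1 t) ?et //=.
  by rewrite !hornerE subrr mul0r.
have shift b : monic_sum lam n =
   \sum_(a : 'rV[F]_n) lam (monic_of a + b *: l).
  rewrite /monic_sum (reindex_inj (addIr (poly_rV (b *: l)))); apply: eq_bigr => a _.
  congr lam; rewrite /monic_of linearD /= poly_rV_K ?addrA //.
  exact: leq_trans (size_scale_leq _ _) szl.
have : #|F|%:R * monic_sum lam n == 0.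
  rewrite mulr_natl -sumr_const (eq_bigr _ (fun b _ => shift b)) exchange_big /=.
  rewrite big1 // => a _.
  pose r := \prod_(t | t != t1) chi (monic_of a).[c t] ^+ e t.
  transitivity (\sum_b chi ((monic_of a).[c t1] + b * l.[c t1]) ^+ e t1 * r).
    apply: eq_bigr => b _; rewrite /lam (bigD1 t1) //= !hornerE; congr (_ * _).
    apply: eq_bigr => t tt1; have [->|/l0] := eqVneq (e t) 0%N; first by rewrite !expr0.
    by rewrite !hornerE => ->; rewrite // mulr0 addr0.
  rewrite -mulr_suml.
  have -> : \sum_b chi ((monic_of a).[c t1] + b * l.[c t1]) ^+ e t1 = 0.
    transitivity (\sum_b chi b ^+ e t1); last by apply: chi_sum0; rewrite e1 e_lt.
    rewrite [RHS](reindex_inj (addrI (monic_of a).[c t1])).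
    by rewrite [RHS](reindex_inj (mulIf l1)).
  by rewrite mul0r.
by rewrite mulf_eq0 pnatr_eq0 gtn_eqF ?(ltnW (finNzRing_gt1 F)) //= => /eqP.
Qed.

Section Points.

Variables (K : closedFieldType) (iota : {rmorphism F -> K}).
Local Notation pts := (subfield_points F K).
Let f : {poly K} := \prod_t ((iota (c t))%:P - 'X) ^+ e t.
(** The product of the norms of c_t - x, to the powers e_t. *)
Definition point_norm k x : F := \prod_t (cpoly iota k x).[c t] ^+ e t.
Local Notation Nx := point_norm.

Lemma poly_char_cpoly k x : lam (cpoly iota k x) = chi (Nx k x).
Proof. by rewrite /Nx chi_prod; apply: eq_bigr => t _; rewrite chiX. Qed.

Lemma iota_Nx k x : (0 < k)%N -> x \in pts k ->
  iota (Nx k x) = f.[x] ^+ (\sum_(i < k) #|F| ^ i).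
Proof.
move=> k0 xk; rewrite /Nx /f rmorph_prod horner_prod -prodrXl; apply: eq_bigr => t _.
rewrite rmorphXn horner_exp -exprM mulnC exprM; congr (_ ^+ _).
rewrite -horner_map cpolyKE // /cpolyK horner_prod expr_sum; apply: eq_bigr => i _.
rewrite !hornerE exprDn_pchar ?(charK_cardX iota) //.
by rewrite exprNn_pchar ?(charK_cardX iota) // iota_fixed.
Qed.

Lemma count_roots k : (0 < k)%N ->
  (count (fun x => Nx k x == 0%R) (pts k) <= m)%N.
Proof.
move=> k0; have nzf : f != 0 := prod_CsubX_neq0 _ _.
have szf : (size f <= m.+1)%N by exact: size_prod_CsubX.
rewrite -size_filter -ltnS; apply: leq_trans szf; apply: max_poly_roots => //.
  apply/allP => x; rewrite mem_filter => /andP[/eqP Nx0 xk].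
  have := iota_Nx k0 xk; rewrite Nx0 rmorph0 => /esym/eqP.
  by rewrite expf_eq0 => /andP[_ ?].
by rewrite filter_uniq // (uniq_pts iota).
Qed.

(** All x with the same nonzero character value have the same power residue
    of their norm, which is a power of f(x); [square_field_bound] applies. *)
Lemma value_count n (B : nat) (z : algC) : (0 < n)%N ->
  (#|F| ^ n = d * B + 1)%N -> ((d * m + 1) * (m + 3) < B)%N -> z != 0 ->
  (count (fun x => lam (cpoly iota n.*2 x) == z) (pts n.*2)
     <= B + m * #|F| ^ n + (B + m + 3) * #|F| ^ n)%N.
Proof.
move=> n0 DB largeB nzz; rewrite -size_filter.
have n20 : (0 < n.*2)%N by rewrite double_gt0.
set xs := filter _ _.
case Dxs : xs => [|x0 xs'].
  by [].
rewrite -Dxs.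
have xsP x : x \in xs -> [/\ Nx n.*2 x != 0, x \in pts n.*2 & chi (Nx n.*2 x) = z].
  rewrite mem_filter poly_char_cpoly => /andP[/eqP E ->]; split=> //.
  by apply: contra nzz => /eqP N0; rewrite -E N0 chi0.
have x0xs : x0 \in xs by rewrite Dxs inE eqxx.
have [N0 _ z0] := xsP x0 x0xs.
have inj_ic : injective (fun t => iota (c t)) by move=> s t /fmorph_inj /inj_c.
have d0 : (0 < d)%N by rewrite ltnW.
apply: (@square_field_bound K I _ e d m B (#|F| ^ n) inj_ic d0 e_prim _ DB
  (charK_cardX iota n) _ largeB (iota (Nx n.*2 x0 ^+ (#|F|.-1 %/ d)))) => //.
- by move=> t; rewrite iota_fixed.
- by rewrite fmorph_eq0 expf_neq0.
- by rewrite filter_uniq // (uniq_pts iota).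
move=> x /xsP[Nz xk zx]; split.
  by apply/eqP; rewrite -expnM muln2 -mem_pts.
rewrite -(chi_eq_power Nz N0) ?zx // rmorphXn iota_Nx // -exprM; congr (_ ^+ _).
apply/eqP; rewrite -(eqn_pmul2l d0); apply/eqP.
rewrite mulnA [(d * B)%N](_ : _ = (#|F| ^ n).-1); last by rewrite DB addn1.
rewrite [RHS]mulnCA [(d * (_ %/ _))%N]mulnC divnK // mulnC [RHS]mulnC -predn_exp.
rewrite -muln2 expnM; set P := (#|F| ^ n)%N.
by rewrite -subn1 -[in RHS]subn1 -[1%N in RHS](exp1n 2) subn_sqr mulnC.
Qed.

End Points.
End Characters.

(** * The Weil bound for primitive exponents *)


Lemma geometric_root_sum (d : nat) (y : algC) : y ^+ d = 1 -> y != 1 ->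
  \sum_(k < d) y ^+ k = 0.
Proof.
move=> yd y1; have := subrX1 y d; rewrite yd subrr => /esym/eqP.
by rewrite mulf_eq0 subr_eq0 (negPf y1) => /eqP.
Qed.

Lemma sum_roots_of_unity (z : algC) d : (1 < d)%N -> d.-primitive_root z ->
  \sum_(j < d) z ^+ j = 0.
Proof.
move=> d1 zd; apply: geometric_root_sum (prim_expr_order zd) _.
apply/eqP => z1; have := eq_prim_root_expr zd 1 0.
by rewrite z1 !expr1n eqxx /eqn mod0n modn_small.
Qed.

(** Each of the d nonzero values is taken at most P^2 / d + O(P) times by
    [square_field_bound], and together they are taken P^2 - O(1) times.  Since
    the values, weighted equally, add up to 0, the sum is bounded by the sum of
    the deficits from the upper bound, which is O(P). *)
Lemma even_point_sum_bound (F : finFieldType) (d : nat) (chi : F -> algC)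
    (I : finType) (c : I -> F) (e : I -> nat)
    (K : closedFieldType) (iota : {rmorphism F -> K}) :
  (1 < d)%N -> (d %| #|F|.-1)%N -> exact_character d chi ->
  injective c -> (forall r, (forall t, d %| r * e t)%N -> (d %| r)%N) ->
  exists (C : algC) (n0 : nat), forall n, (n0 <= n)%N ->
    `|point_sum iota (poly_char chi c e) n.*2| <= C * #|F|%:R ^+ n.
Proof.
move=> d1 dq chiP inj_c e_prim; have d0 := ltnW d1.
set m := (\sum_t e t)%N.
(* the threshold for n is the one that makes B = (P - 1) / d large enough *)
exists (2 * d * m + 3 * d + 1 + m)%:R, (d * ((d * m + 1) * (m + 3) + 1)).+1 => n n_large.
have n0 : (0 < n)%N by apply: leq_trans n_large.
have q1 : (1 < #|F|)%N := finNzRing_gt1 F.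
set P := (#|F| ^ n)%N.
have nP : (n < P)%N by apply: ltn_expl.
pose B := (P.-1 %/ d)%N.
have DP : (P = d * B + 1)%N.
  rewrite /B [(d * _)%N]mulnC divnK ?addn1 ?prednK ?expn_gt0 ?(ltnW q1) //.
  by rewrite predn_exp dvdn_mulr.
have largeB : ((d * m + 1) * (m + 3) < B)%N.
  have : (d * ((d * m + 1) * (m + 3) + 1) <= d * B)%N by lia.
  by rewrite leq_pmul2l // addn1.
have [z zd] := C_prim_root_exists d0.
have nzz : z != 0.
  apply/eqP => z0; have /eqP := prim_expr_order zd.
  by rewrite z0 expr0n gtn_eqF // eq_sym oner_eq0.
have norm_z : `|z| = 1.
  apply/eqP; rewrite -(pexpr_eq1 d0) ?normr_ge0 // -normrX.
  by rewrite (prim_expr_order zd) normr1.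
set pts := subfield_points F K n.*2.
have n20 : (0 < n.*2)%N by rewrite double_gt0.
pose v x := poly_char chi c e (cpoly iota n.*2 x).
have vE x : v x = chi (point_norm c e iota n.*2 x) by rewrite /v (poly_char_cpoly chiP).
pose M (j : 'I_d) := count (fun x => v x == z ^+ j) pts.
pose bnd := (B + m * P + (B + m + 3) * P)%N.
have Mle j : (M j <= bnd)%N.
  apply: (value_count d1 dq chiP inj_c e_prim iota n0 DP largeB).
  by rewrite expf_neq0.
have z_inj (i j : 'I_d) : (z ^+ i == z ^+ j) = (i == j).
  by rewrite (eq_prim_root_expr zd) !modn_small.
have vP x : v x != 0 -> exists j : 'I_d, v x = z ^+ j.
  move=> vx; have Nx0 : point_norm c e iota n.*2 x != 0.
    by apply: contra vx => /eqP E; rewrite vE E (chi0 chiP).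
  have /(prim_rootP zd)[j Hj] : v x ^+ d = 1 by rewrite vE (chi_root chiP).
  by exists j.
have DS : point_sum iota (poly_char chi c e) n.*2 = \sum_(j < d) z ^+ j * (M j)%:R.
  rewrite /point_sum -/pts.
  under [RHS]eq_bigr => j _ do rewrite /M -sum1_count natr_sum mulr_sumr big_mkcond.
  rewrite exchange_big /=; apply: eq_bigr => x _; rewrite -/(v x).
  have [v0|/vP[j Hj]] := eqVneq (v x) 0.
    by rewrite v0 big1 // => j _; have := expf_neq0 j nzz; rewrite eq_sym => /negPf ->.
  rewrite (bigD1 j) //= Hj eqxx mulr1 big1 ?addr0 // => i ij.
  by rewrite z_inj eq_sym (negPf ij).
have sumM : (P ^ 2 - m <= \sum_j M j)%N.
  have -> : (P ^ 2 = size pts)%N by rewrite size_pts // -expnM muln2.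
  have E : (size pts <= \sum_j M j + count (fun x => v x == 0%R) pts)%N.
    rewrite -sum1_size -[X in (_ <= _ + X)%N]sum1_count.
    under [X in (_ <= X + _)%N]eq_bigr => j _ do rewrite /M -sum1_count big_mkcond.
    rewrite exchange_big [X in (_ <= _ + X)%N]big_mkcond -big_split /=.
    apply: leq_sum => x _; have [v0|/vP[j Hj]] := eqVneq (v x) 0; first by rewrite leq_addl.
    by rewrite addn0 (bigD1 j) //= Hj eqxx.
  rewrite leq_subLR addnC; apply: leq_trans E _; rewrite leq_add2l.
  apply: leq_trans (count_roots c e iota n20); apply: sub_count => x /=.
  rewrite vE => /eqP H; apply/negPn/negP => /(chi_neq0 d1 chiP).
  by rewrite H eqxx.
(* the weights z ^ j add up to 0, so the common bound can be subtracted *)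
have -> : point_sum iota (poly_char chi c e) n.*2 = - \sum_(j < d) z ^+ j * (bnd - M j)%:R.
  have bnd0 : \sum_(j < d) z ^+ j * bnd%:R = 0.
    by rewrite -mulr_suml sum_roots_of_unity // mul0r.
  rewrite DS -[LHS]subr0 -[X in _ - X = _]bnd0 -sumrB -sumrN.
  by apply: eq_bigr => j _; rewrite natrB // mulrBr opprB.
rewrite normrN; apply: le_trans (ler_norm_sum _ _ _) _.
have -> : \sum_(j < d) `|z ^+ j * (bnd - M j)%:R| = (\sum_j (bnd - M j))%:R.
  rewrite natr_sum; apply: eq_bigr => j _.
  by rewrite normrM normrX norm_z expr1n mul1r normr_nat.
rewrite -natrX -natrM ler_nat -/P sumnB // sum_nat_const card_ord.
have : (d * bnd <= P ^ 2 + (2 * d * m + 3 * d + 1) * P)%N.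
  have dBP : (d * B <= P)%N by rewrite DP leq_addr.
  have dBPP : (d * B * P <= P * P)%N by rewrite leq_mul2r dBP orbT.
  by move: dBP dBPP; rewrite /bnd -mulnn; clear; lia.
have : (m <= m * P)%N by rewrite leq_pmulr // expn_gt0 ltnW.
move: sumM; lia.
Qed.

(** The hypothesis on r says that no common factor can be removed from d and
    the exponents; for a common factor the curve y^d = f(x) would split. *)
Theorem weil_primitive (F : finFieldType) (d : nat) (chi : F -> algC)
    (I : finType) (c : I -> F) (e : I -> nat) :
  (1 < d)%N -> (d %| #|F|.-1)%N -> exact_character d chi -> injective c ->
  (forall t, (e t < d)%N) ->
  (forall r, (forall t, d %| r * e t)%N -> (d %| r)%N) ->
  `|\sum_x \prod_t chi (x + c t) ^+ e t|
     <= (#|[set t | e t != 0%N]|.-1)%:R * sqrtC #|F|%:R.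
Proof.
move=> d1 dq chiP inj_c e_lt e_prim.
have [K [iota _]] := countable_algebraic_closure F.
set lam := poly_char chi c e; set h := #|[set t | e t != 0%N]|.
have h0 : (0 < h)%N := support_gt0 d1 e_prim.
pose A := monic_sum lam; pose S := point_sum iota lam.
have A0 : A 0%N = 1 by apply: monic_sum0; apply: (poly_char1 chiP).
have Ah n : (h <= n)%N -> A n = 0 by apply: (monic_sum_eq0 d1 dq chiP).
(* the L-function is a polynomial, since A n = 0 for n >= h *)
pose L : {poly algC} := \poly_(n < h) A n.
have coefL n : L`_n = A n by rewrite coef_poly; case: ltnP => // /Ah.
have L0 : L`_0 = 1 by rewrite coefL.
have [ws [sz_ws Dws]] := poly_prod_1subX L0.
have newtonS : newton_rel A S by move=> n; apply: newton_monic_sum; apply: (poly_charM chiP).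
have newtonW : newton_rel A (fun k => - \sum_(w <- ws) w ^+ k).
  move=> n; rewrite -coefL Dws (newton_rel_prod ws).
  by apply: eq_bigr => k _; rewrite -Dws coefL.
have DS k : (0 < k)%N -> S k = - \sum_(w <- ws) w ^+ k.
  exact: newton_rel_unique A0 newtonS newtonW _.
have [C [n0 HC]] := even_point_sum_bound iota d1 dq chiP inj_c e_prim.
have q0 : 0 < #|F|%:R :> algC by rewrite ltr0n ltnW // finNzRing_gt1.
have small w : w \in ws -> `|w| <= sqrtC #|F|%:R.
  move=> wws; have : `|w ^+ 2| <= #|F|%:R.
    apply: (@power_sum_growth [seq w ^+ 2 | w <- ws] C _ n0.+1) => //; last exact: map_f.
    move=> n nn; rewrite big_map.
    rewrite (eq_bigr (fun v => v ^+ n.*2)) => [|v _]; last by rewrite -exprM mul2n.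
    by rewrite -normrN -DS ?HC ?(ltnW nn) // double_gt0; apply: leq_trans nn.
  rewrite normrX => H; rewrite -(ler_pXn2r (n := 2)) ?nnegrE ?sqrtC_ge0 ?normr_ge0 ?(ltW q0) //.
  by rewrite sqrtCK.
have A1 : A 1%N = \sum_x \prod_t chi (x + c t) ^+ e t.
  rewrite /A /monic_sum (reindex (fun x : F => const_mx x : 'rV[F]_1)) /=; last first.
    exists (fun a => a 0 0) => [x _|a _]; first by rewrite mxE.
    by apply/rowP => i; rewrite !mxE ord1.
  apply: eq_bigr => x _; apply: eq_bigr => t _; congr (chi _ ^+ _).
  rewrite /monic_of expr1 !hornerE addrC; congr (_ + _).
  rewrite (_ : rVpoly _ = x%:P) ?hornerC //.
  apply/polyP => i; rewrite coef_rVpoly coefC; case: insubP => [j _ <-|].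
    by rewrite mxE ord1.
  by rewrite -leqNgt; case: i.
rewrite -A1; have : A 1%N = S 1%N.
  by have := newtonS 1%N; rewrite mul1r big_nat1 subnn A0 mulr1.
move=> ->; rewrite DS // normrN; apply: le_trans (ler_norm_sum _ _ _) _.
have sz_le : (size ws <= h.-1)%N.
  by rewrite sz_ws -!subn1 leq_sub2r // size_poly.
apply: le_trans (_ : (size ws)%:R * sqrtC #|F|%:R <= _); last first.
  by rewrite ler_wpM2r ?sqrtC_ge0 ?(ltW q0) // ler_nat.
rewrite -sum1_size natr_sum mulr_suml big_seq [leRHS]big_seq.
by apply: ler_sum => w wws; rewrite expr1 mul1r small.
Qed.

(** * The Weil bound for arbitrary exponents, and auxiliary counts *)


(** Let g be the greatest common divisor of d and the exponents.  Replace the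
    character by its g-th power, of order d / g, and each exponent e by e / g. *)
Theorem weil_bound (F : finFieldType) (d : nat) (chi : F -> algC)
    (I : finType) (c : I -> F) (e : I -> nat) :
  (1 < d)%N -> (d %| #|F|.-1)%N -> exact_character d chi -> injective c ->
  (forall t, (e t < d)%N) -> (exists t, e t != 0%N) ->
  `|\sum_x \prod_t chi (x + c t) ^+ e t|
     <= (#|[set t | e t != 0%N]|.-1)%:R * sqrtC #|F|%:R.
Proof.
move=> d1 dq chiP inj_c e_lt [t0 et0]; have d0 := ltnW d1.
pose g0 := \big[gcdn/0%N]_t e t; pose g := gcdn d g0.
have g_gt0 : (0 < g)%N by rewrite gcdn_gt0 d0.
have gd : (g %| d)%N := dvdn_gcdl _ _.
have ge t : (g %| e t)%N by apply: dvdn_trans (dvdn_gcdr _ _) _; apply: (biggcdn_inf t).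
pose d' := (d %/ g)%N; pose e' t := (e t %/ g)%N.
have Dd : d = (d' * g)%N by rewrite divnK.
have De t : e t = (e' t * g)%N by rewrite divnK.
have e'0 t : (e' t == 0%N) = (e t == 0%N) by rewrite De muln_eq0 [g == _]gtn_eqF ?orbF.
have d'1 : (1 < d')%N.
  rewrite ltnNge; apply: contra et0 => d'1; rewrite -leqn0 -ltnS.
  have := e_lt t0; rewrite Dd De ltn_mul2r g_gt0 /= => /leq_trans /(_ d'1).
  by rewrite ltnS leqn0 => /eqP ->.
have d'q : (d' %| #|F|.-1)%N by apply: dvdn_trans dq; rewrite Dd dvdn_mulr.
pose chi' x := chi x ^+ g.
have chi'P : exact_character d' chi'.
  case: (chiP) => c0 c1 cM cd cK; split; rewrite /chi'.
  - by rewrite c0 expr0n gtn_eqF.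
  - by rewrite c1 expr1n.
  - by move=> x y; rewrite cM exprMn.
  - by move=> x nzx; rewrite -exprM mulnC -Dd cd.
  move=> x nzx; rewrite -(chiX chiP) => /cK; rewrite expf_neq0 // => /(_ isT).
  rewrite -exprM => <-; congr (_ ^+ _).
  apply/eqP; rewrite -(eqn_pmul2r (ltnW d'1)) divnK // -mulnA [(_ * d')%N]mulnC.
  by rewrite mulnA [(g * d')%N]mulnC -Dd mulnC divnK.
have -> : \sum_x \prod_t chi (x + c t) ^+ e t = \sum_x \prod_t chi' (x + c t) ^+ e' t.
  apply: eq_bigr => x _; apply: eq_bigr => t _.
  by rewrite /chi' -exprM mulnC -De.
have -> : [set t | e t != 0%N] = [set t | e' t != 0%N].
  by apply/setP => t; rewrite !inE e'0.
apply: weil_primitive chi'P inj_c _ _ => //.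
  by move=> t; have := e_lt t; rewrite Dd De ltn_mul2r g_gt0.
move=> r Hr; rewrite -(dvdn_pmul2r g_gt0) -Dd.
have Hre t : (d %| r * e t)%N by rewrite De Dd mulnA dvdn_pmul2r.
rewrite /g muln_gcdr dvdn_gcd dvdn_mull //=.
rewrite (big_morph (muln r) (muln_gcdr r) (muln0 r)).
by apply/dvdn_biggcdP.
Qed.

Lemma finField_prim_root (F : finFieldType) :
  exists w : F, (#|F|.-1).-primitive_root w.
Proof.
have q1 : (0 < #|F|.-1)%N by rewrite -ltnS prednK ?finNzRing_gt1 // ltnW // finNzRing_gt1.
have : has (#|F|.-1).-primitive_root (enum (predC1 (0 : F))).
  apply: (has_prim_root q1 _ (enum_uniq _)); last by rewrite -cardE cardC1.
  apply/allP => x; rewrite mem_enum inE => nzx; rewrite unity_rootE.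
  apply/eqP; apply: (mulfI nzx); rewrite -exprS prednK ?expf_card ?mulr1 //.
  by rewrite ltnW // finNzRing_gt1.
by case/hasP => w _ Hw; exists w.
Qed.

(** Send the i-th power of a primitive root to the i-th power of a primitive
    d-th root of unity. *)
Lemma exact_character_exists (F : finFieldType) (d : nat) :
  (0 < d)%N -> (d %| #|F|.-1)%N -> exists chi : F -> algC, exact_character d chi.
Proof.
move=> d0 dq; have [w Hw] := finField_prim_root F.
have [z Hz] := C_prim_root_exists d0.
have wP x : x != 0 -> exists i, x == w ^+ i.
  move=> nzx; have /(prim_rootP Hw)[i ->] : x ^+ #|F|.-1 = 1; last by exists i.
  apply: (mulfI nzx); rewrite -exprS prednK ?expf_card ?mulr1 //.
  by rewrite ltnW // finNzRing_gt1.
pose chi x := if [pick i : 'I_#|F|.-1 | x == w ^+ i] is Some i then z ^+ i else 0.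
have w0 i : w ^+ i != 0.
  apply/eqP => wi; have /eqP := prim_expr_order Hw.
  have nzw : w != 0.
    apply/eqP => w0; have := prim_expr_order Hw; rewrite w0 expr0n gtn_eqF ?(prim_order_gt0 Hw) //.
    by move/eqP; rewrite eq_sym oner_eq0.
  by move/eqP: wi; rewrite expf_eq0 (negPf nzw) andbF.
have chiw i : chi (w ^+ i) = z ^+ i.
  rewrite /chi; case: pickP => [j|none].
    rewrite (eq_prim_root_expr Hw) => /eqP ij.
    by apply/eqP; rewrite (eq_prim_root_expr Hz) -(modn_dvdm _ dq) -ij modn_dvdm.
  have /(prim_rootP Hw)[j Hj] : (w ^+ i) ^+ #|F|.-1 = 1.
    by rewrite exprAC (prim_expr_order Hw) expr1n.
  by have := none j; rewrite Hj eqxx.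
have chi00 : chi 0 = 0.
  by rewrite /chi; case: pickP => // j; rewrite eq_sym (negPf (w0 j)).
exists chi; split=> //.
- by rewrite -(expr0 w) chiw.
- move=> x y; have [->|/wP[i /eqP ->]] := eqVneq x 0; first by rewrite !mul0r chi00 mul0r.
  have [->|/wP[j /eqP ->]] := eqVneq y 0; first by rewrite !mulr0 chi00 mulr0.
  by rewrite -exprD !chiw exprD.
- by move=> x /wP[i /eqP ->]; rewrite chiw exprAC (prim_expr_order Hz) expr1n.
move=> x /wP[i /eqP ->]; rewrite chiw => /eqP; rewrite -(prim_order_dvd Hz) => di.
rewrite -exprM; apply/eqP; rewrite -(prim_order_dvd Hw).
by rewrite -[X in (X %| _)%N](divnK dq) mulnC dvdn_mul.
Qed.

(** Sort the functions by their support, and the supports by their size. *)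
Lemma sum_over_supports (m d : nat) (G : nat -> nat) : (0 < d)%N ->
  (\sum_(k : {ffun 'I_m -> 'I_d}) G #|[set t | (k t != 0 :> nat)%N]| =
   \sum_(0 <= h < m.+1) 'C(m, h) * d.-1 ^ h * G h)%N.
Proof.
move=> d0; pose supp (k : {ffun 'I_m -> 'I_d}) := [set t | (k t != 0 :> nat)%N].
rewrite (partition_big supp xpredT) //=.
transitivity (\sum_(D : {set 'I_m}) d.-1 ^ #|D| * G #|D|)%N.
  apply: eq_bigr => D _.
  transitivity (\sum_(k | supp k == D) G #|D|)%N.
    by apply: eq_bigr => k /eqP <-.
  rewrite sum_nat_cond_const; congr (_ * _)%N.
  pose Q (t : 'I_m) := [pred j : 'I_d | (j != 0 :> nat)%N == (t \in D)].
  transitivity #|family Q|.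
    apply: eq_card => k; rewrite !inE; apply/eqP/familyP => [E t|H].
      by rewrite inE /= -E inE.
    by apply/setP => t; have := H t; rewrite !inE => /eqP.
  transitivity (\sum_(f in family Q) \prod_(t < m) 1)%N.
    by rewrite -sum1_card; apply: eq_bigr => f _; rewrite big1.
  rewrite -(bigA_distr_big_dep Q (fun _ _ => 1%N)).
  rewrite -prod_nat_const [RHS]big_mkcond; apply: eq_bigr => t _.
  rewrite sum1_card /Q; case: (t \in D); last first.
    rewrite (eq_card1 (x := Ordinal d0)) // => j.
    by rewrite unfold_in [RHS]inE -val_eqE /=; case: (nat_of_ord j).
  transitivity #|predC1 (Ordinal d0)|; last by rewrite cardC1 card_ord.
  apply: eq_card => j.
  by rewrite unfold_in [RHS]inE -val_eqE /=; case: (nat_of_ord j).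
rewrite (partition_big (fun D : {set 'I_m} => inord #|D| : 'I_m.+1) xpredT) //=.
rewrite big_mkord; apply: eq_bigr => h _.
have cardD (D : {set 'I_m}) : (inord #|D| == h :> 'I_m.+1) = (#|D| == h :> nat).
  by rewrite -val_eqE /= inordK // ltnS -[X in (_ <= X)%N](card_ord m) max_card.
transitivity (\sum_(D : {set 'I_m} | inord #|D| == h :> 'I_m.+1) d.-1 ^ h * G h)%N.
  by apply: eq_bigr => D; rewrite cardD => /eqP ->.
rewrite sum_nat_cond_const -mulnA; congr (_ * _)%N.
rewrite -[X in 'C(X, _)](card_ord m) -card_draws; apply: eq_card => D.
by rewrite !inE cardD.
Qed.

(** * Elements with prescribed power residues *)


(** The number called U in the bound.  The predecessor is truncated at h = 0,
    where the contribution is 0 instead of - 1. *)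
Definition weil_loss (d m : nat) : nat :=
  (\sum_(0 <= h < m.+1) 'C(m, h) * d.-1 ^ h * h.-1)%N.

Section PrescribedClasses.

Variables (F : finFieldType) (d m : nat) (c beta : 'I_m -> F).
Hypothesis d_gt1 : (1 < d)%N.
Hypothesis d_dvd : (d %| #|F|.-1)%N.
Hypothesis inj_c : injective c.
Hypothesis beta_neq0 : forall t, beta t != 0.
Hypothesis q_large :
  (weil_loss d m)%:R * sqrtC #|F|%:R + (m * d ^ m.-1)%:R < #|F|%:R :> algC.

(** Sum over x the product over t of the character sums sum_k (chi(x + c_t) /
    chi(beta_t))^k.  The product is d^m at a solution; it is 0 at other x, except
    for the m values where some x + c_t vanishes, where it is at most d^(m-1).
    After expansion, the trivial term is q and the others are at most
    U sqrt(q) by [weil_bound]. *)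
Lemma prescribed_classes : exists x, forall t,
  x + c t != 0 /\ (x + c t) ^+ (#|F|.-1 %/ d) = beta t ^+ (#|F|.-1 %/ d).
Proof.
have d0 := ltnW d_gt1.
have [chi chiP] := exact_character_exists d0 d_dvd.
pose y x t := chi (x + c t) / chi (beta t).
have nzb t : chi (beta t) != 0 by apply: (chi_neq0 d_gt1 chiP).
case: (pickP (fun x => [forall t, (x + c t != 0) && (y x t == 1)])) => [x /forallP Hx|none].
  exists x => t; have /andP[nz /eqP yt] := Hx t; split=> //.
  apply: (chi_eq_power d_gt1 chiP) => //.
  by rewrite -[LHS](divfK (nzb t)) -/(y x t) yt mul1r.
exfalso; pose W x := \prod_(t < m) \sum_(k < d) y x t ^+ k.
have y_root x t : x + c t != 0 -> y x t ^+ d = 1.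
  by move=> nz; rewrite /y expr_div_n !(chi_root chiP) // divr1.
have y_zero x t : x + c t = 0 -> \sum_(k < d) y x t ^+ k = 1.
  move=> E; rewrite /y E (chi0 chiP) mul0r (bigD1 (Ordinal d0)) //= expr0 big1 ?addr0 // => k.
  by rewrite -val_eqE /= expr0n => /negPf ->.
have norm_sum_y x t : `|\sum_(k < d) y x t ^+ k| <= d%:R.
  apply: le_trans (ler_norm_sum _ _ _) _.
  rewrite -[X in _ <= X%:R](card_ord d) -sumr_const; apply: ler_sum => k _.
  have [/eqP E|nz] := boolP (x + c t == 0).
    rewrite /y E (chi0 chiP) mul0r expr0n; case: eqP => _ /=; rewrite ?normr1 ?normr0 //.
  have : `|y x t| = 1.
    by apply/eqP; rewrite -(pexpr_eq1 d0) // -normrX y_root // normr1.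
  by rewrite normrX => ->; rewrite expr1n.
have WE : \sum_x W x = \sum_(k : {ffun 'I_m -> 'I_d})
    (\prod_t (chi (beta t))^-1 ^+ k t) * \sum_x \prod_t chi (x + c t) ^+ k t.
  rewrite /W; under eq_bigr => x _ do rewrite bigA_distr_bigA /=.
  rewrite exchange_big /=; apply: eq_bigr => k _.
  rewrite mulr_sumr; apply: eq_bigr => x _; rewrite -big_split; apply: eq_bigr => t _.
  by rewrite /y exprMn mulrC.
have Wle x : `|W x| <= \sum_(t < m) (if x == - c t then (d ^ m.-1)%:R else 0).
  have [/existsP[t /eqP xt]|] := boolP [exists t, x + c t == 0].
    rewrite (bigD1 t) //= [X in _ <= X + _]ifT; last by rewrite -addr_eq0 xt.
    apply: (@le_trans _ _ ((d ^ m.-1)%:R)); last first.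
      by rewrite lerDl sumr_ge0 // => s _; case: ifP.
    rewrite /W (bigD1 t) //= y_zero // mul1r normr_prod.
    apply: (@le_trans _ _ (\prod_(s < m | s != t) d%:R)).
      by apply: ler_prod => s _; rewrite normr_ge0 norm_sum_y.
    by rewrite prodr_const natrX cardC1 card_ord.
  rewrite negb_exists => /forallP nz.
  rewrite big1 => [|t _]; last by rewrite -addr_eq0 (negPf (nz t)).
  have := none x; move=> /negbT; rewrite negb_forall => /existsP[t].
  rewrite nz /= => yt.
  by rewrite /W (bigD1 t) //= geometric_root_sum ?mul0r ?normr0 ?y_root ?nz.
have sumW : `|\sum_x W x| <= (m * d ^ m.-1)%:R.
  apply: le_trans (ler_norm_sum _ _ _) _.
  apply: le_trans (ler_sum _ (fun x _ => Wle x)) _.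
  have -> : (m * d ^ m.-1)%:R = \sum_(t < m) (d ^ m.-1)%:R :> algC.
    by rewrite sumr_const card_ord natrM mulr_natl.
  rewrite exchange_big /=.
  by apply: ler_sum => t _; rewrite -big_mkcond big_pred1_eq.
pose k0 : {ffun 'I_m -> 'I_d} := [ffun=> Ordinal d0].
have term0 : (\prod_t (chi (beta t))^-1 ^+ k0 t) * \sum_x \prod_t chi (x + c t) ^+ k0 t = #|F|%:R.
  rewrite big1 => [|t _]; last by rewrite ffunE.
  rewrite mul1r (eq_bigr (fun=> 1)) => [|x _]; first by rewrite sumr_const.
  by rewrite big1 // => t _; rewrite ffunE.
have terms (k : {ffun 'I_m -> 'I_d}) : k != k0 ->
  `|(\prod_t (chi (beta t))^-1 ^+ k t) * \sum_x \prod_t chi (x + c t) ^+ k t|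
    <= (#|[set t | (k t != 0 :> nat)%N]|.-1)%:R * sqrtC #|F|%:R.
  move=> kk0; rewrite normrM normr_prod big1 ?mul1r => [|t _]; last first.
    rewrite normrX normrV ?unitfE //.
    have -> : `|chi (beta t)| = 1.
      by apply/eqP; rewrite -(pexpr_eq1 d0) // -normrX (chi_root chiP) // normr1.
    by rewrite invr1 expr1n.
  apply: weil_bound chiP inj_c _ _ => //.
  apply/existsP; apply: contraR kk0; rewrite negb_exists => /forallP H.
  apply/eqP/ffunP => t; apply/val_inj; rewrite ffunE /=.
  by have := H t; rewrite negbK => /eqP.
rewrite WE (bigD1 k0) //= term0 in sumW.
set rest := \sum_(k | k != k0) _ in sumW.
have restle : `|rest| <= (weil_loss d m)%:R * sqrtC #|F|%:R.
  apply: le_trans (ler_norm_sum _ _ _) _.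
  apply: le_trans (ler_sum _ terms) _.
  rewrite -mulr_suml /weil_loss -(sum_over_supports m (fun h => h.-1)) //.
  rewrite ler_wpM2r ?sqrtC_ge0 ?ler0n // natr_sum [leRHS](bigD1 k0) //=.
  by rewrite lerDr ler0n.
have : `|#|F|%:R| <= (weil_loss d m)%:R * sqrtC #|F|%:R + (m * d ^ m.-1)%:R :> algC.
  rewrite -{1}[#|F|%:R](addrK rest) addrC; apply: le_trans (ler_normD _ _) _.
  by rewrite normrN lerD.
by rewrite normr_nat => /(lt_le_trans q_large); rewrite ltxx.
Qed.

End PrescribedClasses.

(** * The numerical bound *)


Lemma U_bound_nat (R : rcfType) (d m : nat) : (0 < d)%N ->
  U_bound R d m = (weil_loss d m)%:R.
Proof.
move=> d0; rewrite /U_bound /weil_loss natr_sum [RHS]big_ltn //= muln0 add0r.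
rewrite big_nat [RHS]big_nat; apply: eq_bigr => h /andP[h0 _].
by rewrite !natrM natrX -!subn1 !natrB.
Qed.

(** The left side is t^2 for the positive root t of t^2 = U t + M, so the
    hypothesis says sqrt(q) > t, that is U sqrt(q) < q - M.  As an inequality
    between integers it can be moved to the algebraic numbers. *)
Lemma sqrt_bound (R : rcfType) (U M q : nat) :
  4^-1 * (U%:R + Num.sqrt (U%:R ^+ 2 + 4 * M%:R)) ^+ 2 < q%:R :> R ->
  (M < q)%N /\ (U ^ 2 * q < (q - M) ^ 2)%N.
Proof.
set u : R := U%:R; set mm : R := M%:R; set s := Num.sqrt _ => H.
have u0 : 0 <= u by rewrite ler0n.
have m0 : 0 <= mm by rewrite ler0n.
have s0 : 0 <= s by rewrite sqrtr_ge0.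
have s2 : s ^+ 2 = u ^+ 2 + 4 * mm by rewrite sqr_sqrtr // addr_ge0 ?sqr_ge0 // mulr_ge0.
pose w : R := Num.sqrt q%:R.
have w0 : 0 <= w by rewrite sqrtr_ge0.
have w2 : w ^+ 2 = q%:R by rewrite sqr_sqrtr.
have us : u <= s by rewrite -(ler_pXn2r (n := 2)) ?nnegrE // s2 lerDl mulr_ge0.
have tw : (u + s) / 2 < w.
  rewrite -(ltr_pXn2r (n := 2)) ?nnegrE ?divr_ge0 ?addr_ge0 // w2.
  by apply: le_lt_trans H; rewrite expr_div_n mulrC le_eqVlt; apply/orP; left; apply/eqP; field.
have main : u * w < w ^+ 2 - mm by nra.
have Mq : (M < q)%N.
  rewrite -(ltr_nat R) -w2 -subr_gt0; apply: le_lt_trans main.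
  by rewrite mulr_ge0.
split=> //.
rewrite -(ltr_nat R) natrM !natrX natrB ?(ltnW Mq) // -w2 -exprMn.
by rewrite ltr_pXn2r ?nnegrE ?mulr_ge0 // subr_ge0 w2 ler_nat ltnW.
Qed.

Lemma Q_bound_weil (R : rcfType) (d m q : nat) : (0 < d)%N -> (0 < m)%N ->
  Q_bound R d m < q%:R ->
  (weil_loss d m)%:R * sqrtC q%:R + (m * d ^ m.-1)%:R < q%:R :> algC.
Proof.
move=> d0 m0; rewrite /Q_bound U_bound_nat //.
have -> : 4 * d%:R ^+ (m - 1) * m%:R = 4 * (m * d ^ m.-1)%:R :> R.
  by rewrite subn1 natrM natrX; ring.
case/sqrt_bound => Mq H.
rewrite -ltrBrDr -natrB ?(ltnW Mq) //.
rewrite -(ltr_pXn2r (n := 2)) ?nnegrE ?mulr_ge0 ?sqrtC_ge0 ?ler0n //.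
by rewrite exprMn sqrtCK -!natrX -natrM ltr_nat.
Qed.

(** * Squares as a difference set *)


Lemma odd_card_two_neq0 (F : finFieldType) : odd #|F| -> (2 : F) != 0.
Proof.
move=> oddF; apply/negP => two0.
have char2 : 2%N \in [pchar F] by rewrite inE /= two0.
have : (2%N).-nat #|F| by rewrite -(eq_pnat _ (pcharf_eq char2)) card_finField_pchar.
case/p_natP => -[|k] E; first by have := finNzRing_gt1 F; rewrite E.
by move: oddF; rewrite E expnS oddM.
Qed.

Lemma oppr_neq_self (F : finFieldType) (x : F) : odd #|F| -> x != 0 -> - x != x.
Proof.
move=> oddF nzx; rewrite -subr_eq0 -opprD oppr_eq0 -mulr2n -mulr_natl mulf_eq0.
by rewrite (negPf nzx) orbF odd_card_two_neq0.
Qed.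

Section Paley.

Variable F : finFieldType.
Hypothesis cardF : #|F| = 3 %[mod 4].
Let d := ((#|F| + 1) %/ 2)%N.

Definition squares : {set F} := [set x ^+ 2 | x : F].
Local Notation D := squares.

Let oddF : odd #|F|.
Proof. by rewrite -(@odd_mod #|F| 4) // cardF. Qed.

Let card_eq : #|F| = (4 * (#|F| %/ 4) + 3)%N.
Proof. by rewrite {1}(divn_eq #|F| 4) cardF mulnC. Qed.

Lemma square0 : 0 \in D.
Proof. by apply/imsetP; exists 0; rewrite ?expr0n. Qed.

Lemma squareM x y : x != 0 -> (x ^+ 2 * y \in D) = (y \in D).
Proof.
move=> nzx; apply/imsetP/imsetP => [[z _ E]|[z _ ->]]; last first.
  by exists (x * z); rewrite ?exprMn.
exists (x^-1 * z) => //; rewrite exprMn -E mulrA -exprMn mulVf //.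
by rewrite expr1n mul1r.
Qed.

Lemma square_power u : u != 0 -> (u \in D) = (u ^+ (2 * (#|F| %/ 4) + 1) == 1).
Proof.
move=> nzu; have u1 x : x != 0 -> x ^+ (2 * (2 * (#|F| %/ 4) + 1)) = 1 :> F.
  move=> nzx; apply: (mulfI nzx); rewrite mulr1 -exprS -[RHS]expf_card; congr (_ ^+ _).
  by rewrite [RHS]card_eq; lia.
apply/imsetP/eqP => [[x _ Dx]|E].
  have nzx : x != 0 by apply: contra nzu => /eqP x0; rewrite Dx x0 expr0n.
  by rewrite Dx -exprM u1.
exists (u ^+ (#|F| %/ 4 + 1)) => //; rewrite -exprM.
by rewrite (_ : (_ * 2 = (2 * (#|F| %/ 4) + 1).+1)%N) ?exprS ?E ?mulr1 //; lia.
Qed.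

(** Euler's criterion: (q - 1) / 2 is odd. *)
Lemma squareN u : u != 0 -> (- u \in D) = (u \notin D).
Proof.
move=> nzu; rewrite !square_power ?oppr_eq0 //.
set n := (2 * _ + 1)%N.
have on : odd n by rewrite /n oddD oddM.
rewrite exprNn -signr_odd on expr1 mulN1r.
have : u ^+ n ^+ 2 = 1.
  rewrite -exprM; apply: (mulfI nzu); rewrite mulr1 -exprS -[RHS]expf_card; congr (_ ^+ _).
  by rewrite [RHS]card_eq /n; lia.
have n1 : (-1 == 1 :> F) = false.
  exact: (negbTE (oppr_neq_self oddF (oner_neq0 F))).
move/eqP; rewrite sqrf_eq1 => /orP[]/eqP ->; rewrite ?opprK n1 ?eqxx //.
Qed.

Lemma card_squares : #|D| = d.
Proof.
have cardD0 : #|D :\ 0| = #|~: D|.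
  rewrite -(card_imset _ (@oppr_inj F)); apply: eq_card => u.
  apply/imsetP/idP => [[x]|].
    by rewrite !inE => /andP[nzx xD] ->; rewrite squareN // negbK.
  rewrite inE => uD; have nzu : u != 0 by apply: contra uD => /eqP ->; apply: square0.
  by exists (- u); rewrite ?opprK // !inE oppr_eq0 nzu squareN.
have := cardsC D; rewrite -cardD0 (cardsD1 0 D) square0 /= /d.
have := card_eq; set k := (_ %/ 4)%N; move=> -> H.
rewrite (_ : _ %/ 2 = 2 * k + 2)%N; last by rewrite (_ : _ + 1 = (2 * k + 2) * 2)%N ?mulnK //; lia.
by move: H; set b := #|_|; lia.
Qed.

(** The first members of the pairs of squares whose difference is u. *)
Definition shifted_squares (u : F) : {set F} := [set a in D | a - u \in D].
Local Notation N := shifted_squares.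

Lemma card_shiftedM x u : x != 0 -> #|N (x ^+ 2 * u)| = #|N u|.
Proof.
move=> nzx; have nzx2 : x ^+ 2 != 0 by rewrite expf_neq0.
rewrite -[RHS](card_imset _ (mulfI nzx2)); apply: eq_card => a.
have E (b : F) : (x ^+ 2 * b \in N (x ^+ 2 * u)) = (b \in N u).
  by rewrite !inE -mulrBr !squareM.
apply/idP/imsetP => [aN|[b bN ->]]; last by rewrite E.
by exists ((x ^+ 2)^-1 * a); rewrite -?E mulrA divff ?mul1r.
Qed.

Lemma card_shiftedN u : #|N (- u)| = #|N u|.
Proof.
rewrite -[LHS](card_imset _ (addIr u)); apply: eq_card => a.
apply/imsetP/idP => [[b]|]; rewrite !inE.
  by rewrite opprK => /andP[bD buD] ->; rewrite buD addrK.
move=> /andP[aD auD]; exists (a - u); last by rewrite subrK.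
by rewrite !inE auD opprK subrK.
Qed.

Lemma card_shifted_const u : u != 0 -> #|N u| = #|N 1|.
Proof.
have sq v : v != 0 -> v \in D -> #|N v| = #|N 1|.
  move=> nzv /imsetP[x _ E]; rewrite E -[x ^+ 2]mulr1 card_shiftedM //.
  by apply: contra nzv => /eqP x0; rewrite E x0 expr0n.
move=> nzu; have [uD|uD] := boolP (u \in D); first exact: sq.
by rewrite -card_shiftedN sq ?oppr_eq0 // squareN.
Qed.

(** The number of representations of u is invariant under multiplication of u
    by nonzero squares and by -1, hence it is the same for all nonzero u.
    There are d (d - 1) pairs and 2 (d - 1) nonzero differences. *)
Lemma paley_difference_set u : u != 0 -> (2 * #|N u| = d)%N.
Proof.
move=> nzu; rewrite card_shifted_const //.
have tot : (\sum_(v | v != 0%R) #|N v| = d * d.-1)%N.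
  transitivity (\sum_(a in D) #|D :\ a|)%N; last first.
    rewrite (eq_bigr (fun=> d.-1)) ?sum_nat_const ?card_squares // => a aD.
    by rewrite -card_squares (cardsD1 a D) aD.
  rewrite (eq_bigr (fun v => \sum_(a in D) ((a - v)%R \in D))%N); last first.
    move=> v _; rewrite -sum1_card big_mkcond [RHS]big_mkcond; apply: eq_bigr => a _.
    by rewrite inE; case: (a \in D); case: (_ \in D).
  rewrite exchange_big; apply: eq_bigr => a aD.
  rewrite -sum1_card (reindex_inj (subrI a)) /= big_mkcond [RHS]big_mkcond.
  apply: eq_bigr => b _; rewrite subKr subr_eq0 eq_sym !inE.
  by case: (b == a); case: (b \in D).
rewrite (eq_bigr (fun=> #|N 1|)) in tot; last by move=> v /card_shifted_const.
rewrite sum_nat_cond_const in tot.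
have cF : #|[set v : F | v != 0]| = #|F|.-1.
  by rewrite -(cardC1 (0 : F)); apply: eq_card => v; rewrite !inE.
have k0 : d = (2 * (#|F| %/ 4) + 2)%N.
  rewrite /d {1}card_eq (_ : _ + 1 = (2 * (#|F| %/ 4) + 2) * 2)%N ?mulnK //; lia.
move: tot; rewrite (_ : #|_| = #|F|.-1); last first.
  by rewrite -(cardC1 (0 : F)); apply: eq_card => v; rewrite !inE.
have -> : (#|F|.-1 = 2 * d.-1)%N by rewrite card_eq k0; lia.
move=> /eqP; rewrite mulnAC eqn_pmul2r; first by move/eqP.
by rewrite k0; lia.
Qed.

End Paley.

(** * Greedy choice of elements with prescribed residues *)


Lemma size_filter_notin (T : finType) (s : seq T) : uniq s ->
  size [seq z <- enum T | z \notin s] = (#|T| - size s)%N.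
Proof.
move=> us.
have E : count (mem s) (enum T) = size s.
  rewrite -size_filter; apply/perm_size/uniq_perm => //.
    by rewrite filter_uniq // enum_uniq.
  by move=> x; rewrite mem_filter mem_enum andbT.
by rewrite cardT -(count_predC (mem s) (enum T)) E size_filter addKn.
Qed.

Section Residues.

Variables (F : finFieldType) (d m : nat).
Hypothesis d_gt1 : (1 < d)%N.
Hypothesis d_dvd : (d %| #|F|.-1)%N.
Hypothesis q_large :
  (weil_loss d m)%:R * sqrtC #|F|%:R + (m * d ^ m.-1)%:R < #|F|%:R :> algC.

Definition residue (u : F) : F := u ^+ (#|F|.-1 %/ d).

Lemma residueM u v : residue (u * v) = residue u * residue v.
Proof. exact: exprMn. Qed.

(** The list is completed to m distinct points, the additional ones with target
    class 1. *)
Lemma prescribed_residues (ps : seq (F * F)) :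
  uniq (unzip1 ps) -> (forall p, p \in ps -> p.2 != 0) -> (size ps <= m)%N ->
  exists x, forall p, p \in ps -> x - p.1 != 0 /\ residue (x - p.1) = residue p.2.
Proof.
move=> ups nz szm.
have mq : (m <= #|F|)%N.
  apply: leq_trans (leq_pmulr m (_ : 0 < d ^ m.-1)%N) _; first by rewrite expn_gt0 ltnW.
  rewrite ltnW // -(ltr_nat algC); apply: le_lt_trans q_large.
  by rewrite lerDr mulr_ge0 // sqrtC_ge0.
pose fresh := [seq z <- enum F | z \notin unzip1 ps].
pose cs := unzip1 ps ++ take (m - size ps) fresh.
have szp : size (unzip1 ps) = size ps by rewrite size_map.
have szcs : size cs = m.
  rewrite size_cat szp size_takel ?subnKC //.
  by rewrite size_filter_notin // szp leq_sub2r.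
have ucs : uniq cs.
  rewrite cat_uniq; apply/and3P; split=> //.
    by apply/hasPn => z /mem_take; rewrite mem_filter => /andP[].
  by apply/take_uniq/filter_uniq/enum_uniq.
pose c (t : 'I_m) := - nth 0 cs t.
pose beta (t : 'I_m) := nth 1 (unzip2 ps) t.
have inj_c : injective c.
  move=> s t /oppr_inj /eqP; rewrite nth_uniq ?szcs // => /eqP; exact: val_inj.
have nzb t : beta t != 0.
  rewrite /beta; have [ts|ts] := ltnP t (size (unzip2 ps)); last by rewrite nth_default ?oner_neq0.
  by have /mapP[p pp ->] := mem_nth 1 ts; apply: nz.
have [x Hx] := prescribed_classes d_gt1 d_dvd inj_c nzb q_large.
exists x => p pp; have ip : (index p ps < size ps)%N by rewrite index_mem.
have im : (index p ps < m)%N by apply: leq_trans szm.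
have [] := Hx (Ordinal im); rewrite /c /beta /cs /= nth_cat szp ip.
by rewrite (nth_map p) // (nth_map p) // nth_index.
Qed.

Hypothesis odd_card : odd #|F|.
Hypothesis residueN1 : residue (-1) = 1.

Definition signed (tau : bool) (u : F) : F := (-1) ^+ tau * u.

Lemma signedK tau : involutive (signed tau).
Proof. by move=> u; rewrite /signed mulrA -signr_addb addbb mul1r. Qed.

Lemma signed_eq0 tau u : (signed tau u == 0) = (u == 0).
Proof. by rewrite /signed mulf_eq0 signr_eq0. Qed.

Lemma residue_signed tau u : residue (signed tau u) = residue u.
Proof. by case: tau; rewrite /signed ?expr1 ?expr0 ?mul1r // residueM residueN1 mul1r. Qed.

(** For a new index i and the earlier ones j, the conditions concern x - 0,
    x - y_j and x + y_j.  These points are distinct: y_j is neither 0 nor - y_j,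
    and y_j = +- y_k is excluded by the conditions already satisfied. *)
Lemma greedy_residues (T : eqType) (b0 : T -> F) (b : T -> T -> bool -> F) (l : seq T) :
  (forall i, b0 i != 0) -> (forall i j tau, b i j tau != 0) ->
  (forall i j tau, b i j tau = b j i tau) -> uniq l -> (2 * size l <= m.+1)%N ->
  exists y : T -> F,
    (forall i, i \in l -> y i != 0 /\ residue (y i) = residue (b0 i)) /\
    (forall i j tau, i \in l -> j \in l -> i != j ->
       y i - signed tau (y j) != 0 /\
       residue (y i - signed tau (y j)) = residue (b i j tau)).
Proof.
move=> nzb0 nzb bC; elim: l => [|i l IH] /=.
  by move=> _ _; exists (fun=> 0); split=> // i j tau; rewrite in_nil.
move=> /andP[il ul] szl; have [||y [Hy0 Hy]] := IH => //; first by lia.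
pose ps := (0, b0 i) :: [seq (signed p.2 (y p.1), b i p.1 p.2) | p <- [seq (j, tau) | j <- l, tau <- [:: false; true]]].
have Dps1 : unzip1 ps = 0 :: [seq signed p.2 (y p.1) | p <- [seq (j, tau) | j <- l, tau <- [:: false; true]]].
  by rewrite /ps /unzip1 /= -map_comp.
have memp j (tau : bool) : ((j, tau) \in [seq (j, tau) | j <- l, tau <- [:: false; true]]) = (j \in l).
  apply/allpairsP/idP => [[[j' t'] /= [? _ [-> _]]] //|jl].
  by exists (j, tau); split=> //=; case: tau.
have ups : uniq (unzip1 ps).
  rewrite Dps1 /=; apply/andP; split.
    apply/negP => /mapP[[j tau]]; rewrite memp /= => jl /esym/eqP.
    by rewrite signed_eq0; have [/negPf ->] := Hy0 j jl.
  have upairs : uniq [seq (j, tau) | j <- l, tau <- [:: false; true]].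
    by apply: allpairs_uniq => // -[j1 t1] [j2 t2].
  rewrite map_inj_in_uniq //.
  move=> [j tau] [j' tau']; rewrite !memp /= => jl jl' E.
  have Ejj : j = j'.
    apply/eqP/negPn/negP => jj'.
    have [] := Hy j j' (tau (+) tau') jl jl' jj'.
    rewrite subr_eq0 => /eqP; case.
    by rewrite -(signedK tau (y j)) E /signed mulrA -signr_addb.
  rewrite -Ejj in E *; congr (_, _); apply/eqP/negPn/negP => tt'.
  have nzy := (Hy0 j jl).1; have := oppr_neq_self odd_card nzy; move: E.
  rewrite /signed; case: tau tau' tt' => [] [] //= _;
    by rewrite expr0 expr1 mulN1r mul1r => E2 /eqP; apply.
have [||x Hx] := prescribed_residues ups.
- move=> p; rewrite inE => /orP[/eqP -> //|/mapP[[j tau] _ ->]] //=.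
- have -> : size ps = (size l * 2).+1.
    by rewrite -(size_allpairs (fun j tau => (j, tau)) l [:: false; true]) -(size_map (fun p => (signed p.2 (y p.1), b i p.1 p.2))).
  by lia.
exists (fun j => if j == i then x else y j); split=> [j|j k tau].
  rewrite inE; case: eqP => [-> _|_ /= jl]; last exact: Hy0.
  by have := Hx (0, b0 i) (mem_head _ _); rewrite /= subr0.
have xj j' tau' : j' \in l -> x - signed tau' (y j') != 0 /\
    residue (x - signed tau' (y j')) = residue (b i j' tau').
  move=> jl; apply: (Hx (signed tau' (y j'), b i j' tau')); rewrite inE; apply/orP; right.
  by apply/mapP; exists (j', tau'); rewrite ?memp.
rewrite !inE; case: eqP => [-> _|_ /= jl]; case: eqP => [-> _|_ /= kl]; rewrite ?eqxx //.
  by move=> _; apply: xj.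
  move=> _; have [nx rx] := xj j tau jl.
  have -> : y j - signed tau x = signed (~~ tau) (x - signed tau (y j)).
    by rewrite /signed; case: (tau); rewrite /= ?expr0 ?expr1; ring.
  by rewrite signed_eq0 residue_signed bC.
exact: Hy.
Qed.

End Residues.

(** * From a frame difference family to a resolvable design *)


Section FrameDesign.

Variables (Fp Fq : finFieldType) (T : finType) (Bs : T -> {set Fp * Fq}).
Local Notation G := (Fp * Fq)%type.
Local Notation V := (option G).

Hypothesis card_base : forall s, #|Bs s| = (#|Fp| + 1)%N.
Hypothesis diff_ex : forall w : G, w.2 != 0 ->
  exists s u v, [/\ u \in Bs s, v \in Bs s & u - v = w].
Hypothesis diff_uniq : forall s u v s' u' v', u \in Bs s -> v \in Bs s ->
  u' \in Bs s' -> v' \in Bs s' -> (u - v).2 != 0 -> u - v = u' - v' ->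
  s = s' /\ u = u'.
Hypothesis diff_proper : forall s u v, u \in Bs s -> v \in Bs s -> u != v ->
  (u - v).2 != 0.
Hypothesis cover_ex : forall b, b != 0 -> exists s u, u \in Bs s /\ u.2 = b.
Hypothesis cover_uniq : forall s u s' u', u \in Bs s -> u' \in Bs s' ->
  u.2 = u'.2 -> s = s'.
Hypothesis cover_neq0 : forall s u, u \in Bs s -> u.2 != 0.

Definition block (s : T) (g : G) : {set V} := [set Some (u + g) | u : G in Bs s].
Definition fiber (b : Fq) : {set V} := None |: [set Some (a, b) | a : Fp].
Definition design_blocks : {set {set V}} :=
  [set block x.1 x.2 | x : T * G] :|: [set fiber b | b : Fq].
Definition parallel_class (b : Fq) : {set {set V}} :=
  fiber b |: [set block x.1 (x.2, b) | x : T * Fp].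
Definition design_classes : {set {set {set V}}} := [set parallel_class b | b : Fq].

Lemma mem_block s g w : (Some w \in block s g) = (w - g \in Bs s).
Proof.
apply/imsetP/idP => [[u us [->]]|ws]; first by rewrite addrK.
by exists (w - g); rewrite ?subrK.
Qed.

Lemma None_block s g : (None \in block s g) = false.
Proof. by apply/negP => /imsetP[]. Qed.

Lemma mem_fiber b w : (Some w \in fiber b) = (w.2 == b).
Proof.
rewrite !inE /=; apply/imsetP/eqP => [[a _ [->]] //|<-].
by exists w.1; rewrite //; case: w.
Qed.

Lemma None_fiber b : None \in fiber b.
Proof. by rewrite !inE. Qed.

Lemma fiber_inj : injective fiber.
Proof.
by move=> b b' E; apply/eqP; rewrite -(mem_fiber b' (0, b)) -E mem_fiber.
Qed.

Lemma card_block s g : #|block s g| = (#|Fp| + 1)%N.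
Proof. by rewrite card_imset ?card_base // => u v /Some_inj /addIr. Qed.

Lemma card_fiber b : #|fiber b| = (#|Fp| + 1)%N.
Proof.
have nN : None \notin [set Some (a, b) | a : Fp] by apply/negP => /imsetP[].
have inj_b : injective (fun a : Fp => Some (a, b)) by move=> a a' [].
by rewrite cardsU1 nN (card_imset _ inj_b) add1n addn1.
Qed.

Lemma snd_sub (u v : G) : (u - v).2 = u.2 - v.2. Proof. by []. Qed.

(** The difference of the two points determines the base block and the two
    points of it. *)
Lemma block_eq s g s' g' w w' : w.2 != w'.2 ->
  Some w \in block s g -> Some w' \in block s g ->
  Some w \in block s' g' -> Some w' \in block s' g' -> s = s' /\ g = g'.
Proof.
move=> ww'; rewrite !mem_block => h1 h2 h3 h4.
have E : (w - g) - (w' - g) = w - w' by rewrite opprB addrA subrK.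
have E' : (w - g') - (w' - g') = w - w' by rewrite opprB addrA subrK.
have [|->] := diff_uniq h1 h2 h3 h4 _ (etrans E (esym E')).
  by rewrite E snd_sub subr_eq0.
by move/addrI/oppr_inj ->.
Qed.

Lemma block_two_points s g : exists w w', [/\ w.2 != w'.2,
  Some w \in block s g & Some w' \in block s g].
Proof.
have /card_gt1P[u [v [us vs uv]]] : (1 < #|Bs s|)%N.
  by rewrite card_base addn1 ltnS; apply/card_gt0P; exists 0.
exists (u + g), (v + g); rewrite !mem_block !addrK; split=> //=.
by have := diff_proper us vs uv; rewrite snd_sub subr_eq0 (inj_eq (addIr _)).
Qed.

Lemma block_inj s g s' g' : block s g = block s' g' -> s = s' /\ g = g'.
Proof.
move=> E; have [w [w' [ww' h h']]] := block_two_points s g.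
by apply: (block_eq ww' h h'); rewrite -E.
Qed.

Lemma block_fiber s g b : block s g <> fiber b.
Proof. by move=> E; have := None_fiber b; rewrite -E None_block. Qed.

Lemma design_blocksP B : reflect
  ((exists s g, B = block s g) \/ (exists b, B = fiber b)) (B \in design_blocks).
Proof.
rewrite inE; apply: (iffP orP) => [[/imsetP[[s g] _ ->]|/imsetP[b _ ->]]|].
- by left; exists s, g.
- by right; exists b.
case=> [[s [g ->]]|[b ->]]; [left|right]; apply/imsetP; last by exists b.
by exists (s, g).
Qed.

Lemma block_blocks s g : block s g \in design_blocks.
Proof. by apply/design_blocksP; left; exists s, g. Qed.

Lemma fiber_blocks b : fiber b \in design_blocks.
Proof. by apply/design_blocksP; right; exists b. Qed.

Lemma parallel_classP b B : reflect
  (B = fiber b \/ exists s a, B = block s (a, b)) (B \in parallel_class b).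
Proof.
rewrite !inE; apply: (iffP orP) => [[/eqP ->|/imsetP[[s a] _ ->]]|].
- by left.
- by right; exists s, a.
case=> [->|[s [a ->]]]; [left; exact: eqxx|right].
by apply/imsetP; exists (s, a).
Qed.

Lemma fiber_class b : fiber b \in parallel_class b.
Proof. by apply/parallel_classP; left. Qed.

(** Pairs in a common fiber, or with infinity, are covered by the fiber only,
    since distinct points of a base block have distinct second coordinates; the
    remaining pairs are covered according to their difference. *)
Lemma pair_cover (x y : V) : x != y ->
  exists2 B, B \in design_blocks & [/\ x \in B, y \in B &
    forall B', B' \in design_blocks -> x \in B' -> y \in B' -> B' = B].
Proof.
have main (u : G) (z : V) : Some u != z -> exists2 B, B \in design_blocks &
   [/\ Some u \in B, z \in B &
    forall B', B' \in design_blocks -> Some u \in B' -> z \in B' -> B' = B].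
  case: z => [v|] uv; last first.
    exists (fiber u.2); first exact: fiber_blocks.
    split; rewrite ?mem_fiber ?None_fiber // => B' /design_blocksP[[s [g ->]]|[b ->]].
      by rewrite None_block.
    by rewrite mem_fiber => /eqP ->.
  have {}uv : u != v by apply: contra uv => /eqP ->.
  have [E|uv2] := eqVneq u.2 v.2.
    exists (fiber u.2); first exact: fiber_blocks.
    rewrite !mem_fiber E eqxx; split=> // B' /design_blocksP[[s [g ->]]|[b ->]].
      rewrite !mem_block => us vs; have := diff_proper us vs.
      rewrite (inj_eq (addIr _)) uv snd_sub /= => /(_ isT).
      by rewrite E subrr eqxx.
    by rewrite mem_fiber E => /eqP ->.
  have [|s [u0 [v0 [us vs E]]]] := @diff_ex (u - v).
    by rewrite snd_sub subr_eq0.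
  have hu : Some u \in block s (u - u0) by rewrite mem_block opprB addrCA subrr addr0.
  have hv : Some v \in block s (u - u0).
    rewrite mem_block (_ : v - (u - u0) = v0) //.
    by rewrite opprB addrCA -[v - u]opprB -E opprB addrCA subrr addr0.
  exists (block s (u - u0)); first exact: block_blocks.
  split=> // B' /design_blocksP[[s' [g' ->]]|[b ->]] h h'.
    by have [-> ->] := block_eq uv2 h h' hu hv.
  by move: h h' uv2; rewrite !mem_fiber => /eqP -> /eqP ->; rewrite eqxx.
case: x => [u|] xy; first exact: main.
case: y xy => [v|] // _.
have [B AB [h1 h2 h3]] := @main v None isT.
by exists B => //; split=> // B' AB' n v'; apply: h3.
Qed.

Lemma design_BIBD : is_BIBD (#|Fp| * #|Fq| + 1) (#|Fp| + 1) 1 design_blocks.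
Proof.
split.
- by rewrite card_option card_prod addn1.
- by move=> B /design_blocksP[[s [g ->]]|[b ->]]; rewrite ?card_block ?card_fiber.
move=> S /eqP/cards2P[x [y [xy ->]]].
have [B AB [xB yB Bu]] := pair_cover xy.
apply/eqP/cards1P; exists B; apply/setP => B'; rewrite in_set in_set1 subUset !sub1set.
apply/idP/eqP => [/andP[AB' /andP[xB' yB']]|->]; first exact: Bu.
by rewrite AB xB yB.
Qed.

Lemma class_partition b : partition (parallel_class b) [set: V].
Proof.
have disj x B B' : B \in parallel_class b -> B' \in parallel_class b ->
    x \in B -> x \in B' -> B = B'.
  have fb s a w : Some w \in block s (a, b) -> w.2 != b.
    by rewrite mem_block => /cover_neq0; rewrite snd_sub subr_eq0.
  case: x => [w|] /parallel_classP[->|[s [a ->]]] /parallel_classP[->|[s' [a' ->]]] //;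
    rewrite ?None_block //.
  - by rewrite mem_fiber => /eqP E /fb; rewrite E eqxx.
  - by move=> /fb wb; rewrite mem_fiber (negPf wb).
  rewrite !mem_block => h h'.
  have E : s = s' by apply: cover_uniq h h' _.
  rewrite -E in h' *; congr (block _ _); apply: oppr_inj; apply: (addrI w).
  apply/eqP/negPn/negP => /(diff_proper h h').
  by rewrite snd_sub subrr eqxx.
apply/and3P; split.
- apply/eqP/setP => x; rewrite inE; apply/bigcupP; case: x => [w|]; last first.
    by exists (fiber b); [exact: fiber_class | exact: None_fiber].
  have [E|wb] := eqVneq w.2 b.
    by exists (fiber b); [exact: fiber_class | rewrite mem_fiber E].
  have [|s [u [us Eu]]] := @cover_ex (w.2 - b); first by rewrite subr_eq0.
  exists (block s (w.1 - u.1, b)).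
    by apply/parallel_classP; right; exists s, (w.1 - u.1).
  rewrite mem_block (_ : w - _ = u) //.
  case: w u us Eu {wb} => [w1 w2] [u1 u2] /= us ->.
  by congr (_, _); rewrite /= ?opprB addrCA ?subrr ?addr0.
- apply/trivIsetP => B B' hB hB' BB'; rewrite -setI_eq0.
  apply/set0Pn => -[x]; rewrite inE => /andP[xB xB'].
  by move/eqP: BB'; apply; apply: disj xB xB'.
apply/negP => /parallel_classP[E|[s [a E]]].
  by have := None_fiber b; rewrite -E inE.
have [w [_ [_ h _]]] := block_two_points s (a, b).
by move: h; rewrite -E inE.
Qed.

Lemma class_disjoint b b' B :
  B \in parallel_class b -> B \in parallel_class b' -> b = b'.
Proof.
move=> /parallel_classP[->|[s [a ->]]] /parallel_classP[|[s' [a']]].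
- by move/fiber_inj.
- by move/esym/block_fiber.
- by move/block_fiber.
by case/block_inj => _ [].
Qed.

Lemma design_resolution : is_resolution design_blocks design_classes.
Proof.
split; last by move=> P /imsetP[b _ ->]; apply: class_partition.
apply/and3P; split.
- apply/eqP/setP => B; apply/bigcupP/design_blocksP => [[P /imsetP[b _ ->]]|].
    by case/parallel_classP=> [->|[s [a ->]]]; [right; exists b | left; exists s, (a, b)].
  case=> [[s [[a b] ->]]|[b ->]]; exists (parallel_class b); rewrite ?imset_f ?fiber_class //.
  by apply/parallel_classP; right; exists s, a.
- apply/trivIsetP => P P' /imsetP[b _ ->] /imsetP[b' _ ->] bb'; rewrite -setI_eq0.
  apply/set0Pn => -[B]; rewrite inE => /andP[h h'].
  by move/eqP: bb'; apply; rewrite (class_disjoint h h').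
apply/negP => /imsetP[b _ E].
by have := fiber_class b; rewrite -E inE.
Qed.

Definition shift (g : G) (x : V) : V := if x is Some u then Some (u + g) else None.

Lemma shift_inj g : injective (shift g).
Proof. by case=> [u|] [v|] //= /Some_inj /addIr ->. Qed.

(** Translations fix the point at infinity. *)
Definition translation (g : G) : {perm V} := perm (@shift_inj g).

Lemma translationE g x : translation g x = shift g x.
Proof. exact: permE. Qed.

Lemma translationM : {in [set: G] &, {morph translation : g h / (g * h)%g}}.
Proof.
move=> g h _ _; apply/permP => x; rewrite permM !translationE.
by case: x => [u|] //=; rewrite -addrA.
Qed.

Canonical translation_morphism := Morphism translationM.

Lemma translation_injm : ('injm translation_morphism)%g.
Proof.
apply/injmP => g h _ _ /permP/(_ (Some 0)); rewrite /= !translationE /= !add0r.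
by move/Some_inj.
Qed.

Lemma translation_block h s g : translation h @: block s g = block s (g + h).
Proof.
apply/setP => -[w|]; last first.
  by rewrite None_block; apply/imsetP => -[[u|]]; rewrite ?None_block // translationE.
rewrite mem_block; apply/imsetP/idP => [[[u|]]|ws].
- by rewrite mem_block translationE => us /Some_inj ->; rewrite opprD addrACA subrr addr0.
- by rewrite None_block.
exists (Some (w - h)); last by rewrite translationE /= subrK.
by rewrite mem_block -addrA -opprD [h + g]addrC.
Qed.

Lemma translation_fiber h b : translation h @: fiber b = fiber (b + h.2).
Proof.
apply/setP => -[w|]; last first.
  by rewrite None_fiber; apply/imsetP; exists None; rewrite ?None_fiber // translationE.
rewrite mem_fiber; apply/imsetP/eqP => [[[u|]]|E].
- by rewrite mem_fiber translationE => /eqP <- /Some_inj ->.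
- by rewrite translationE.
exists (Some (w - h)); last by rewrite translationE /= subrK.
by rewrite mem_fiber snd_sub E addrK.
Qed.

Lemma translation_class h b :
  [set translation h @: B | B : {set V} in parallel_class b] = parallel_class (b + h.2).
Proof.
apply/setP => B; apply/imsetP/parallel_classP => [[B0]|].
  case/parallel_classP => [->|[s [a ->]]] ->.
    by left; rewrite translation_fiber.
  by right; exists s, (a + h.1); rewrite translation_block.
case=> [->|[s [a ->]]].
  by exists (fiber b); rewrite ?fiber_class // translation_fiber.
exists (block s (a - h.1, b)); first by apply/parallel_classP; right; exists s, (a - h.1).
by rewrite translation_block; congr (block _ (_, _)); rewrite /= subrK.
Qed.

Lemma translation_automorphism h :
  [set translation h @: B | B : {set V} in design_blocks] = design_blocks /\
  [set [set translation h @: B | B : {set V} in P] | P : {set {set V}} in design_classes]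
    = design_classes.
Proof.
split; apply/setP.
  move=> B; apply/imsetP/design_blocksP => [[B0]|].
    case/design_blocksP => [[s [g ->]]|[b ->]] ->.
      by left; exists s, (g + h); rewrite translation_block.
    by right; exists (b + h.2); rewrite translation_fiber.
  case=> [[s [g ->]]|[b ->]].
    exists (block s (g - h)); first exact: block_blocks.
    by rewrite translation_block subrK.
  exists (fiber (b - h.2)); first exact: fiber_blocks.
  by rewrite translation_fiber subrK.
move=> P; apply/imsetP/imsetP => [[P0 /imsetP[b _ ->] ->]|[b _ ->]].
  by exists (b + h.2); rewrite ?translation_class.
exists (parallel_class (b - h.2)); first exact: imset_f.
by rewrite translation_class subrK.
Qed.

(** A frame difference family: the differences of distinct points of a base
    block have nonzero second coordinate, all base blocks together represent each
    such difference once, and their second coordinates represent each nonzero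
    element once. *)
Theorem frame_design : one_rotational_RBIBD [set: Fp * Fq]%G
  (#|Fp| * #|Fq| + 1) (#|Fp| + 1) 1 design_blocks design_classes.
Proof.
split.
- by split; [exact: design_BIBD | exact: design_resolution].
- by rewrite cardsT card_prod addn1 subn1.
exists (translation_morphism @* [set: Fp * Fq])%G, None.
have imP g : g \in (translation_morphism @* [set: Fp * Fq])%g -> exists h, g = translation h.
  by case/morphimP => h _ _ ->; exists h.
split.
- by rewrite isog_sym sub_isog ?translation_injm.
- by move=> g /imP[h ->]; apply: translation_automorphism.
- by move=> g /imP[h ->]; rewrite translationE.
move=> [u|] [v|] // _ _; exists (translation (v - u)); split.
  split; last by rewrite translationE /= addrC subrK.
  by apply: mem_morphim; rewrite inE.
move=> g [/imP[h ->]]; rewrite translationE /= => /Some_inj <-.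
by rewrite addrC addKr.
Qed.

End FrameDesign.

(** * The frame difference family *)


Section Construction.

Variables (Fp Fq : finFieldType).
Let d := ((#|Fp| + 1) %/ 2)%N.
Hypothesis p_mod4 : #|Fp| = 3 %[mod 4].
Hypothesis q_mod : #|Fq| = 1 %[mod #|Fp| + 1].
Hypothesis q_large : (weil_loss d #|Fp|)%:R * sqrtC #|Fq|%:R +
  (#|Fp| * d ^ #|Fp|.-1)%:R < #|Fq|%:R :> algC.

Local Notation D := (squares Fp).
Local Notation res := (@residue Fq d).

Lemma card_Fp_mod4 : exists k, #|Fp| = (4 * k + 3)%N /\ d = (2 * k + 2)%N.
Proof.
exists (#|Fp| %/ 4)%N; have E : #|Fp| = (4 * (#|Fp| %/ 4) + 3)%N.
  by rewrite {1}(divn_eq #|Fp| 4) p_mod4 mulnC.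
split=> //; rewrite /d {1}E; move: (_ %/ 4)%N => k.
by rewrite (_ : _ + 1 = (2 * k + 2) * 2)%N ?mulnK //; lia.
Qed.

Lemma half_order_gt1 : (1 < d)%N. Proof. by have [k [_ ->]] := card_Fp_mod4; lia. Qed.

Lemma card_Fp_succ : (#|Fp| + 1 = 2 * d)%N. Proof. by have [k [-> ->]] := card_Fp_mod4; lia. Qed.

Lemma card_Fq_gt0 : (0 < #|Fq|)%N. Proof. by rewrite ltnW // finNzRing_gt1. Qed.

Lemma order_dvd_card : (2 * d %| #|Fq|.-1)%N.
Proof.
rewrite -card_Fp_succ -subn1; move/eqP: q_mod; rewrite eqn_mod_dvd //; exact: card_Fq_gt0.
Qed.

Lemma half_order_dvd_card : (d %| #|Fq|.-1)%N.
Proof. by apply: dvdn_trans order_dvd_card; rewrite dvdn_mull. Qed.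

Lemma odd_card_Fq : odd #|Fq|.
Proof.
have : (2 %| #|Fq|.-1)%N by apply: dvdn_trans order_dvd_card; rewrite dvdn_mulr.
by rewrite dvdn2 -[in odd #|Fq|](prednK card_Fq_gt0) /= => ->.
Qed.

Lemma res_N1 : res (-1) = 1.
Proof.
have [k Dk] := dvdnP order_dvd_card; rewrite /residue Dk mulnA mulnK ?(ltnW half_order_gt1) //.
by rewrite exprM sqrr_sign.
Qed.

Lemma res_neq0 u : u != 0 -> res u != 0.
Proof. by move=> nzu; rewrite expf_neq0. Qed.

Lemma res_pow_d u : u != 0 -> res u ^+ d = 1.
Proof.
move=> nzu; rewrite /residue -exprM divnK ?half_order_dvd_card //.
by apply: (mulfI nzu); rewrite -exprS prednK ?card_Fq_gt0 // expf_card mulr1.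
Qed.

(** There are at most d residues, the d-th roots of unity, so d distinct ones
    exhaust them. *)
Lemma res_surjective (X : finType) (A : {set X}) (f : X -> Fq) : #|A| = d ->
  (forall x, x \in A -> f x != 0) ->
  {in A &, injective (fun x => res (f x))} ->
  forall eta, eta != 0 -> exists2 x, x \in A & res (f x) = res eta.
Proof.
move=> cA nzf inj_f eta nze.
case: (pickP (fun x => (x \in A) && (res (f x) == res eta))) => [x /andP[xA /eqP E]|none].
  by exists x.
pose rs := res eta :: [seq res (f x) | x <- enum A].
have urs : uniq rs.
  rewrite /= map_inj_in_uniq ?enum_uniq ?andbT; last first.
    by move=> x x'; rewrite !mem_enum; apply: inj_f.
  apply/mapP => -[x]; rewrite mem_enum => xA E.
  by have := none x; rewrite xA E eqxx.
have nzX : 'X^d - 1 != 0 :> {poly Fq} by rewrite -size_poly_gt0 size_XnsubC // ltnW // half_order_gt1.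
have : all (root ('X^d - 1)) rs.
  have rootd u : u != 0 -> root ('X^d - 1 : {poly Fq}) (res u).
    by move=> nzu; rewrite rootE !hornerE res_pow_d // subrr.
  rewrite /= rootd //; apply/allP => z /mapP[x]; rewrite mem_enum => xA ->.
  by apply: rootd; apply: nzf.
move/(max_poly_roots nzX)/(_ urs).
by rewrite /= size_map -cardE cA size_XnsubC ?ltnn // ltnW // half_order_gt1.
Qed.

(** The prescribed coset of y_a - y_b and of y_a + y_b, for tau = false and
    true.  Differences delta and - delta have the same coset conditions, since
    -1 is a d-th power; so the pair is numbered through the one of a - b, b - a
    that is a square. *)
Definition pair_color (a b : Fp) (tau : bool) : nat :=
  if a - b \in D then ((index a (enum (shifted_squares (a - b)%R))).*2 + tau)%N
  else ((index b (enum (shifted_squares (b - a)%R))).*2 + tau)%N.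

Lemma sub_square_sym a b : a != b -> (b - a \in D) = (a - b \notin D).
Proof. by move=> ab; rewrite -opprB squareN // subr_eq0. Qed.

Lemma pair_colorC a b tau : pair_color a b tau = pair_color b a tau.
Proof.
have [-> //|ab] := eqVneq a b.
by rewrite /pair_color (sub_square_sym ab); case: (a - b \in D).
Qed.

Lemma pair_color_main a b (tau : bool) : a != b -> a \in D -> b \in D -> a - b \in D ->
  [/\ pair_color a b tau = ((index a (enum (shifted_squares (a - b)%R))).*2 + tau)%N,
      a \in enum (shifted_squares (a - b)%R) & (pair_color a b tau < d)%N].
Proof.
move=> ab aD bD abD; rewrite /pair_color abD.
have aN : a \in enum (shifted_squares (a - b)%R) by rewrite mem_enum inE aD subKr.
split=> //; have := aN; rewrite -index_mem -cardE.
have := paley_difference_set p_mod4 (u := a - b); rewrite subr_eq0 -/d => /(_ ab) E.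
by move: E; set c := #|_|; set j := index _ _; case: tau => /= E; lia.
Qed.

Lemma pair_color_lt a b tau : a != b -> a \in D -> b \in D -> (pair_color a b tau < d)%N.
Proof.
move=> ab aD bD; have [abD|abD] := boolP (a - b \in D).
  by have [] := pair_color_main tau ab aD bD abD.
rewrite pair_colorC; rewrite eq_sym in ab.
by have [] := @pair_color_main b a tau ab bD aD; rewrite // sub_square_sym 1?eq_sym.
Qed.

Lemma pair_color_inj a b a' b' tau tau' : a \in D -> b \in D -> a' \in D -> b' \in D ->
  a != b -> a - b = a' - b' -> pair_color a b tau = pair_color a' b' tau' ->
  a = a' /\ tau = tau'.
Proof.
have main x y x' y' : x \in D -> y \in D -> x' \in D -> y' \in D -> x != y ->
    x - y \in D -> x - y = x' - y' -> pair_color x y tau = pair_color x' y' tau' ->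
    x = x' /\ tau = tau'.
  move=> xD yD xD' yD' xy xyD E.
  have xy' : x' != y' by rewrite -subr_eq0 -E subr_eq0.
  have [-> xN _] := pair_color_main tau xy xD yD xyD.
  have xyD' : x' - y' \in D by rewrite -E.
  have [-> xN' _] := pair_color_main tau' xy' xD' yD' xyD'.
  rewrite -E in xN' * => EE.
  have [Ei ->] : index x (enum (shifted_squares (x - y)%R)) =
    index x' (enum (shifted_squares (x - y)%R)) /\ tau = tau'.
    move: EE; move: (index x _) (index x' _) => i j EE.
    by case: tau tau' EE => [] [] /= EE; split=> //; clear - EE; lia.
  by split=> //; apply: index_inj Ei; rewrite /= ?xN ?xN'.
move=> aD bD aD' bD' ab E EE; have [abD|abD] := boolP (a - b \in D).
  exact: (main a b a' b').
have baD : b - a \in D by rewrite sub_square_sym.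
rewrite pair_colorC [RHS]pair_colorC in EE.
have E' : b - a = b' - a' by rewrite -opprB E opprB.
rewrite eq_sym in ab.
have [Eb ->] := main b a b' a' bD aD bD' aD' ab baD E' EE.
by split=> //; apply: oppr_inj; apply: (addrI b); rewrite E' Eb.
Qed.

Lemma base_residues : exists y : Fp -> Fq,
  [/\ forall a, a \in D -> y a != 0,
      {in D &, injective (fun a => res (y a))},
      forall a b tau, a \in D -> b \in D -> a != b -> y a - signed tau (y b) != 0 &
      forall a b tau a' b' tau', a \in D -> b \in D -> a' \in D -> b' \in D ->
        a != b -> a - b = a' - b' ->
        res (y a - signed tau (y b)) = res (y a' - signed tau' (y b')) ->
        a = a' /\ tau = tau'].
Proof.
have [w Hw] := finField_prim_root Fq.
have nzw i : w ^+ i != 0.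
  apply: expf_neq0; apply/eqP => w0; have /eqP := prim_expr_order Hw.
  by rewrite w0 expr0n gtn_eqF ?(prim_order_gt0 Hw) // eq_sym oner_eq0.
have res_w i j : (i < d)%N -> (j < d)%N -> res (w ^+ i) = res (w ^+ j) -> i = j.
  move=> id jd; rewrite /residue -!exprM => /eqP; rewrite (eq_prim_root_expr Hw).
  have e0 : (0 < #|Fq|.-1 %/ d)%N.
    by rewrite divn_gt0 ?(ltnW half_order_gt1) // dvdn_leq ?half_order_dvd_card // (prim_order_gt0 Hw).
  move: e0; set e := (_ %/ d)%N => e0.
  have De : (#|Fq|.-1 = e * d)%N by rewrite divnK // half_order_dvd_card.
  rewrite De [(i * e)%N]mulnC [(j * e)%N]mulnC -!muln_modr !modn_small //.
  by rewrite eqn_pmul2l // => /eqP.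
have szD : size (enum D) = d by rewrite -cardE card_squares.
have size_greedy : (2 * size (enum D) <= #|Fp|.+1)%N by rewrite szD -card_Fp_succ addn1.
have [] := greedy_residues half_order_gt1 half_order_dvd_card q_large odd_card_Fq res_N1
  (b0 := fun a => w ^+ index a (enum D)) (b := fun a b tau => w ^+ pair_color a b tau)
  (fun _ => nzw _) (fun _ _ _ => nzw _) _ (enum_uniq D) size_greedy.
  by move=> a b tau; rewrite pair_colorC.
move=> y [Hy0 Hy]; exists y.
have memD a : a \in D -> a \in enum D by rewrite mem_enum.
split.
- by move=> a /memD /Hy0[].
- move=> a b aD bD; rewrite (Hy0 a (memD _ aD)).2 (Hy0 b (memD _ bD)).2.
  by move/res_w; rewrite -szD !index_mem !mem_enum => /(_ aD bD) E; apply: (index_inj a _ _ E); apply: memD.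
- by move=> a b tau aD bD ab; have [] := Hy a b tau (memD _ aD) (memD _ bD) ab.
move=> a b tau a' b' tau' aD bD aD' bD' ab E.
have ab' : a' != b' by rewrite -subr_eq0 -E subr_eq0.
rewrite (Hy a b tau (memD _ aD) (memD _ bD) ab).2.
rewrite (Hy a' b' tau' (memD _ aD') (memD _ bD') ab').2.
by move/res_w => H; apply: (pair_color_inj (b := b) (b' := b')) => //; apply: H; apply: pair_color_lt.
Qed.

(** One of each pair u, -u of d-th powers; the enumeration order of the field
    makes the choice. *)
Definition half_kernel : {set Fq} :=
  [set u | [&& u != 0, res u == 1 & (enum_rank u < enum_rank (- u))%N]].
Local Notation S := half_kernel.

Lemma half_kernel_neq0 u : u \in S -> u != 0.
Proof. by rewrite inE => /and3P[]. Qed.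

Lemma res_half_kernel u : u \in S -> res u = 1.
Proof. by rewrite inE => /and3P[_ /eqP]. Qed.

Lemma half_kernel_ex u : u != 0 -> res u = 1 -> exists tau, signed tau u \in S.
Proof.
move=> nzu ru; have ne : enum_rank u != enum_rank (- u) :> nat.
  by rewrite (inj_eq val_inj) (inj_eq enum_rank_inj) eq_sym oppr_neq_self ?odd_card_Fq.
have : (enum_rank u < enum_rank (- u))%N || (enum_rank (- u) < enum_rank u)%N.
  by rewrite -neq_ltn.
case/orP => lt; [exists false | exists true].
  by rewrite /signed expr0 mul1r inE nzu ru eqxx.
by rewrite /signed expr1 mulN1r inE oppr_eq0 nzu -mulN1r residueM res_N1 mul1r ru eqxx mulN1r opprK.
Qed.

Lemma half_kernel_uniq u v tau tau' : u \in S -> v \in S ->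
  signed tau u = signed tau' v -> u = v /\ tau = tau'.
Proof.
rewrite !inE => /and3P[_ _ hu] /and3P[_ _ hv].
have no : u = - v -> False.
  by move=> E; move: hu; rewrite E opprK => /(ltn_trans hv); rewrite ltnn.
rewrite /signed; case: tau tau' => [] []; rewrite ?expr0 ?expr1 ?mul1r ?mulN1r.
- by move/oppr_inj.
- by move=> E; case: no; rewrite -E opprK.
- by move/no.
- by [].
Qed.

(** Two points of the base block of s differ by an expression of the form
    (a - b, +- s (y_a -+ y_b)).  Hence a given difference determines first a, b and
    the inner sign by its coset, then s and the outer sign because S is half of
    the d-th powers. *)
Lemma one_rotational_RBIBD_exists : exists (V : finType) (A : {set {set V}}) (Rs : {set {set {set V}}}),
  one_rotational_RBIBD [set: Fp * Fq]%G (#|Fp| * #|Fq| + 1) (#|Fp| + 1) 1 A Rs.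
Proof.
have [y [y0 y_inj yy0 yy_inj]] := base_residues.
pose T : finType := {s : Fq | s \in S}.
pose pt (s : T) (a : Fp) (e : bool) : Fp * Fq := (a, val s * signed e (y a)).
pose Bs (s : T) : {set Fp * Fq} := [set pt s x.1 x.2 | x in setX D [set: bool]].
have nzs (s : T) : val s != 0 by apply: half_kernel_neq0 (valP s).
have res_s (s : T) : res (val s) = 1 by apply: res_half_kernel (valP s).
have BsP s u : reflect (exists a e, a \in D /\ u = pt s a e) (u \in Bs s).
  apply: (iffP imsetP) => [[[a e]]|[a [e [aD ->]]]].
    by rewrite in_setX /= => /andP[aD _] ->; exists a, e.
  by exists (a, e); rewrite // in_setX aD inE.
have res_sg tau u : res (signed tau u) = res u := residue_signed res_N1 tau u.
have diffE s a b e e' : (pt s a e - pt s b e').2 =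
    signed e (val s) * (y a - signed (e (+) e') (y b)).
  rewrite /= /signed signr_addb.
  have : (-1 : Fq) ^+ e * (-1) ^+ e = 1 by rewrite -signr_addb addbb.
  move: ((-1) ^+ e) ((-1) ^+ e') (val s) (y a) (y b) => e1 e2 z ya yb e11.
  rewrite mulrBr !mulrA; congr (_ - _); first by rewrite [z * e1]mulrC.
  by rewrite [e1 * z]mulrC -[z * e1 * e1]mulrA e11 mulr1.
have doubleE a e e' : e != e' -> y a - signed (e (+) e') (y a) = 2 * y a.
  case: e e' => [] [] //= _; rewrite /signed expr1; ring.
have nz2 : (2 : Fq) != 0 := odd_card_two_neq0 odd_card_Fq.
have ys0 a b e e' : a \in D -> b \in D -> (a, e) != (b, e') ->
    y a - signed (e (+) e') (y b) != 0.
  move=> aD bD; have [<-|ab] := eqVneq a b; last by move=> _; apply: yy0.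
  by rewrite xpair_eqE eqxx => /doubleE ->; rewrite mulf_neq0 ?y0.
have diff_kernel (eta x : Fq) : x != 0 -> eta != 0 -> res x = res eta ->
    exists (s : T) e, eta = signed e (val s) * x.
  move=> nzx nze E; have nz : eta / x != 0 by rewrite mulf_neq0 // invr_neq0.
  have r1 : res (eta / x) = 1.
    by apply: (mulIf (res_neq0 nzx)); rewrite -residueM divfK // mul1r E.
  have [e He] := half_kernel_ex nz r1.
  by exists (Sub (signed e (eta / x)) He : T), e; rewrite SubK signedK divfK.
exists (option (Fp * Fq)), (design_blocks Bs), (design_classes Bs).
apply: frame_design.
- move=> s; rewrite card_in_imset => [|[a e] [b e']].
    by rewrite cardsX card_squares // cardsT card_bool mulnC -/d -card_Fp_succ.
  rewrite !in_setX /= => /andP[aD _] /andP[bD _] [ab].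
  move/(mulfI (nzs s)) => E; rewrite -ab in E *; congr (_, _).
  apply/eqP/negPn/negP => ee'; have := ys0 a a e e' aD aD.
  rewrite xpair_eqE eqxx => /(_ ee') /negP; apply.
  rewrite subr_eq0 /signed signr_addb -mulrA -/(signed e' _) -E.
  by rewrite -/(signed e (signed e _)) signedK.
- move=> [delta eta] /= nze; have [->|nzd] := eqVneq delta 0.
    have nz2y a : a \in D -> 2 * y a != 0 by move=> aD; rewrite mulf_neq0 // y0.
    have inj2y : {in D &, injective (fun a => res (2 * y a))}.
      by move=> a b aD bD; rewrite /= !residueM => /(mulfI (res_neq0 nz2)); apply: y_inj.
    have [x xD Ex] := res_surjective (card_squares p_mod4) nz2y inj2y nze.
    have [s [e He]] := diff_kernel eta (2 * y x) (mulf_neq0 nz2 (y0 _ xD)) nze Ex.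
    exists s, (pt s x e), (pt s x (~~ e)); split; try by apply/BsP; exists x; eexists; split.
    rewrite [LHS]surjective_pairing diffE doubleE; last by case: (e).
    by rewrite -He /= subrr.
  pose N := setX (shifted_squares delta) [set: bool].
  have cN : #|N| = d.
    by rewrite cardsX cardsT card_bool mulnC paley_difference_set.
  have ND a e : (a, e) \in N -> [/\ a \in D, a - delta \in D & a != a - delta].
    rewrite in_setX /= !inE => /andP[/andP[aD adD] _]; split=> //.
    by rewrite -subr_eq0 subKr.
  pose f x := y x.1 - signed x.2 (y (x.1 - delta)).
  have nzf x : x \in N -> f x != 0.
    by case: x => a e /ND[aD adD ad]; apply: yy0.
  have inj_f : {in N &, injective (fun x => res (f x))}.
    move=> [a e] [b e'] /ND[aD adD ad] /ND[bD bdD bd] /= E.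
    have Eab : a - (a - delta) = b - (b - delta) by rewrite !subKr.
    by have /= [-> ->] := yy_inj _ _ _ _ _ _ aD adD bD bdD ad Eab E.
  have [[a e] /ND[aD adD ad] Ex] := res_surjective cN nzf inj_f nze.
  have [s [t Ht]] := diff_kernel eta _ (yy0 _ _ _ aD adD ad) nze Ex.
  exists s, (pt s a t), (pt s (a - delta) (t (+) e)); split.
  + by apply/BsP; exists a, t.
  + by apply/BsP; exists (a - delta), (t (+) e).
  by rewrite [LHS]surjective_pairing diffE addKb -Ht /= subKr.
- move=> s u v s' u' v' /BsP[a [e [aD ->]]] /BsP[b [t [bD ->]]].
  move=> /BsP[a' [e' [aD' ->]]] /BsP[b' [t' [bD' ->]]] nz E.
  have E1 : a - b = a' - b' by have := congr1 (fun x => x.1) E.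
  have E2 := congr1 (fun x => x.2) E; rewrite !diffE in E2 nz.
  have [nzs1 nzy] : signed e (val s) != 0 /\ y a - signed (e (+) t) (y b) != 0.
    by apply/andP; rewrite -negb_or -mulf_eq0.
  have rE : res (y a - signed (e (+) t) (y b)) = res (y a' - signed (e' (+) t') (y b')).
    by have := congr1 res E2; rewrite [LHS]residueM [RHS]residueM !res_sg !res_s !mul1r.
  (* when a = b the two points have opposite signs and differ by 2 y_a *)
  have [ea ed] : a = a' /\ y a - signed (e (+) t) (y b) = y a' - signed (e' (+) t') (y b').
    have [ab|ab] := eqVneq a b; last first.
      have [ea et] := yy_inj _ _ _ _ _ _ aD bD aD' bD' ab E1 rE.
      split=> //; rewrite et -ea; congr (_ - signed _ (y _)).
      by apply: oppr_inj; apply: (addrI a); rewrite E1 -ea.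
    have ab' : a' = b' by apply/eqP; rewrite -subr_eq0 -E1 ab subrr.
    have et : e != t.
      by apply: contra nzy => /eqP ->; rewrite ab addbb /signed expr0 mul1r subrr.
    have et' : e' != t'.
      apply: contraNneq nzy => Et; rewrite -(mulrI_eq0 _ (mulfI nzs1)) E2 Et ab'.
      by rewrite addbb /signed expr0 mul1r subrr mulr0.
    rewrite -ab -ab' !doubleE // in rE *.
    have -> : a = a'; last by [].
    apply: y_inj => //; apply: (mulfI (res_neq0 nz2)).
    by move: rE; rewrite !residueM.
  rewrite -ed in E2; have [Es Ee] := half_kernel_uniq (valP s) (valP s') (mulIf nzy E2).
  have {}Es : s = s' by apply: val_inj.
  by split=> //; rewrite Es ea Ee.
- move=> s u v /BsP[a [e [aD ->]]] /BsP[b [t [bD ->]]] uv.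
  rewrite diffE mulf_neq0 ?signed_eq0 // ys0 //.
  by apply: contra uv => /eqP[-> ->].
- move=> b nzb; have [a aD Ea] := res_surjective (card_squares p_mod4) y0 y_inj nzb.
  have [s [e He]] := diff_kernel b (y a) (y0 _ aD) nzb Ea.
  exists s, (pt s a e); split; first by apply/BsP; exists a, e.
  by rewrite He /= /signed mulrCA mulrA.
- move=> s u s' u' /BsP[a [e [aD ->]]] /BsP[a' [e' [aD' ->]]] /= E.
  have Ea : a = a'.
    apply: y_inj => //; have := congr1 res E.
    by rewrite [LHS]residueM [RHS]residueM !res_s !mul1r !res_sg.
  have E2 : signed e (val s) = signed e' (val s').
    apply: (mulIf (y0 _ aD)); move: E; rewrite -Ea /signed.
    by rewrite ![_ * (_ * y a)]mulrA ![val _ * _]mulrC.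
  by have [/val_inj] := half_kernel_uniq (valP s) (valP s') E2.
move=> s u /BsP[a [e [aD ->]]] /=.
by rewrite mulf_neq0 ?signed_eq0 ?nzs ?y0.
Qed.

End Construction.

Local Close Scope ring_scope.
(* A finite field is a group under addition here, so [set: Fp * Fq] is the
   direct product of the two additive groups. *)
Theorem theorem4p11 (R : rcfType) (p q : nat)
    (hp : prime_power p) (hq : prime_power q)
    (hp4 : p = 3 %[mod 4]) (hqp : q = 1 %[mod p + 1])
    (hQ : (Q_bound R ((p + 1) %/ 2) p < q%:R)%R)
    (Fp Fq : finFieldType) (hFp : #|Fp| = p) (hFq : #|Fq| = q) :
  exists (V : finType) (A : {set {set V}}) (Rs : {set {set {set V}}}),
    one_rotational_RBIBD [set: Fp * Fq]%G (p * q + 1) (p + 1) 1 A Rs.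
Proof.
subst p q; apply: one_rotational_RBIBD_exists => //.
apply: Q_bound_weil hQ; last by rewrite ltnW // finNzRing_gt1.
by rewrite divn_gt0 // addn1 ltnS ltnW // finNzRing_gt1.
Qed.
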